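(* If $(K,\{V_\lambda\}_{\lambda\in\widehat{A}})$ and $(S,\{W_\lambda\}_{\lambda\in\widehat{A}})$ are equivalent dynamical data for $(H,A)$, then the dynamical twists associated to them are gauge equivalent.
   Context: **Conventions.** $\Bbbk$ is an algebraically closed field of characteristic $0$; $H$ is a finite-dimensional Hopf algebra over $\Bbbk$ with comultiplication $\Delta$, counit $\varepsilon$, antipode $\mathcal{S}$; $A$ is a finite abelian subgroup of the group $G(H)$ of group-like elements; $\widehat{A}$ is its character group. For $\mu\in\widehat{A}$, $P_\mu=\frac{1}{|A|}\sum_{a\in A}\mu(a^{-1})a$, and for an $A$-module $V$, $V[\mu]=\{v: a\cdot v=\mu(a)v\ \forall a\in A\}$. $\mathrm{Rep}(H)$ is the category of finite-dimensional left $H$-modules; $X^*$ is the dual module, $(h\cdot f)(x)=f(\mathcal{S}(h)x)$. All modules are finite-dimensional. **Dynamical twists.** A dynamical twist is a function $J:\widehat{A}\to H\otimes H$ with invertible values such that for all $\lambda\in\widehat{A}$, $a\in A$: $J(\lambda)(a\otimes a)=(a\otimes a)J(\lambda)$; $\sum_{\mu\in\widehat{A}}(\Delta\otimes \mathrm{id})J(\lambda)\,(J(\lambda\mu^{-1})\otimes P_\mu)=(\mathrm{id}\otimes\Delta)J(\lambda)\,(1\otimes J(\lambda))$; $(\varepsilon\otimes \mathrm{id})J(\lambda)=(\mathrm{id}\otimes\varepsilon)J(\lambda)=1$. Two dynamical twists $J,J'$ are gauge equivalent if there is a function $t:\widehat{A}\to H$ with invertible values such that for all $\lambda,a$: $\varepsilon(t(\lambda))=1$,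 $t(\lambda)a=a\,t(\lambda)$, and $J'(\lambda)=\Delta(t(\lambda)^{-1})\,J(\lambda)\sum_{\mu\in\widehat{A}}(t(\lambda\mu^{-1})\otimes P_\mu t(\lambda))$. **Comodule algebras.** A (finite-dimensional) left $H$-comodule algebra $K$ with coaction $\delta(k)=k_{(-1)}\otimes k_{(0)}$ is $H$-simple if it has no non-trivial two-sided ideal $I$ with $\delta(I)\subseteq H\otimes I$; $K^{\mathrm{co}H}=\{k:\delta(k)=1\otimes k\}$. For $X\in \mathrm{Rep}(H)$ and a left $K$-module $V$, $X\otimes_{\Bbbk}V$ is a $K$-module via $k\cdot(x\otimes v)=k_{(-1)}x\otimes k_{(0)}v$. ${}^H\mathcal{M}_S$ is the category of left $H$-comodules that are right $S$-modules with $S$-action an $H$-comodule map; for $P\in{}^H\mathcal{M}_S$, $\mathrm{End}_S(P)$ is a left $H$-comodule algebra with coaction $T\mapsto T_{(-1)}\otimes T_{(0)}$ determined by $\langle\alpha,T_{(-1)}\rangle T_{(0)}(p)=\langle\alpha,T(p_{(0)})_{(-1)}\mathcal{S}^{-1}(p_{(-1)})\rangle T(p_{(0)})_{(0)}$ for $\alpha\in H^*$, $p\in P$. **Yan–Zhu stabilizers.** For left $K$-modules $V,W$, let $\mathcal{L}:H^*\otimes\mathrm{Hom}(V,W)\to\mathrm{Hom}(H^*\otimes V,H^*\otimes W)$, $\mathcal{L}(\gamma\otimes T)(\xi\otimes v)=\gamma\xi\otimes T(v)$, and $\mathrm{Stab}_K(V,W)=\mathrm{Hom}_K(H^*\otimes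 V,H^*\otimes W)\cap\mathcal{L}(H^*\otimes\mathrm{Hom}(V,W))$, where $K$ acts on $H^*\otimes V$ by $k\cdot(\gamma\otimes v)=(k_{(-1)}\rightharpoondown\gamma)\otimes k_{(0)}v$ with $\langle h\rightharpoondown\gamma,t\rangle=\langle\gamma,\mathcal{S}^{-1}(h)t\rangle$. Elements of $H^*\otimes \mathrm{Hom}(V,W)$ are regarded as linear functions $G:H\to\mathrm{Hom}(V,W)$, and $H$ acts by $(h\cdot G)(t)=G(th)$. For $\mu\in\widehat{A}$, $C(\mu)=\{f\in H^*: f(ah)=\mu(a)f(h)\ \forall a\in A,h\in H\}$, an $H$-module via $(h\cdot f)(t)=f(th)$. **Dynamical data.** A dynamical datum for $(H,A)$ is $(K,\{V_\lambda\}_{\lambda\in\widehat{A}})$ where $K$ is an $H$-simple left $H$-comodule algebra, semisimple as an algebra, with $K^{\mathrm{co}H}=\Bbbk$, and $V_\lambda$ are irreducible $K$-modules such that for all $\lambda,\mu$ there are $H$-module isomorphisms $\mathrm{Stab}_K(V_\lambda,V_\mu)\simeq C(\lambda\mu^{-1})$. Two data $(K,\{V_\lambda\})$, $(S,\{W_\lambda\})$ are equivalent if there is $P\in{}^H\mathcal{M}_S$ with $K\simeq\mathrm{End}_S(P)$ as $H$-comodule algebras and $K$-module isomorphisms $\phi_\lambda:P\otimes_S W_\lambda\to V_\lambda$ for all $\lambda\in\widehat{A}$. **Dynamical twist associated to a datum.** Given $(K,\{V_\lambda\})$, choose $H$-module isomorphisms $\omega_{\lambda,\mu}:\mathrm{Stab}_K(V_\lambda,V_\mu)\to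 C(\lambda\mu^{-1})$ such that $\omega_{\lambda,\lambda}$ sends the identity to the counit $\varepsilon$. For $X\in\mathrm{Rep}(H)$, $x\in X[\mu]$, define the $K$-map $\Psi(\lambda,x):X^*\otimes V_\lambda\to V_{\lambda\mu}$ by $\Psi(\lambda,x)(f\otimes v)=\omega_{\lambda,\lambda\mu}^{-1}(\widetilde f^{x})(1)(v)$ with $\widetilde f^{x}(h)=f(\mathcal{S}(h)x)$; this gives a linear isomorphism $X[\mu]\simeq\mathrm{Hom}_K(X^*\otimes V_\lambda,V_{\lambda\mu})$. There is a unique $I(\lambda)\in H\otimes H$ such that for all $X,Y\in\mathrm{Rep}(H)$, $x\in X[\mu]$, $y\in Y[\eta]$: $\Psi(\lambda,I(\lambda)(x\otimes y))=\Psi(\lambda\mu,y)(\mathrm{id}_{Y^*}\otimes\Psi(\lambda,x))$, under the canonical identification $(X\otimes Y)^*\otimes V_\lambda\simeq Y^*\otimes(X^*\otimes V_\lambda)$. $I(\lambda)$ is invertible, with inverse written $I^{-1}(\lambda)\otimes I^{-2}(\lambda)$ (sum understood), and $J(\lambda)=\mathcal{S}^{-1}(I^{-2}(\lambda))\otimes\mathcal{S}^{-1}(I^{-1}(\lambda))$ is a dynamical twist; it is called the dynamical twist associated to $(K,\{V_\lambda\})$ (it depends on the choice of the $\omega_{\lambda,\mu}$; any choice is allowed). *)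

(* Defs.v *)
From HB Require Import structures.
From mathcomp Require Import all_boot all_order all_algebra all_fingroup.
From mathcomp Require Import all_solvable all_field.

Set Implicit Arguments.
Unset Strict Implicit.
Unset Printing Implicit Defensive.

Import GRing.Theory VectorInternalTheory.
Local Open Scope ring_scope.

Section Tensor.
Variable k : fieldType.
Implicit Types A B U V W : vectType k.

(* The matrix z : tens V W stands for the sum of the z_ij e_i (x) f_j, where
   (e_i) and (f_j) are the reference bases of V and W. *)
Definition tens V W := 'M[k]_(dim V, dim W).
HB.instance Definition _ V W := Vector.copy (tens V W) 'M[k]_(dim V, dim W).

Definition pure V W (v : V) (w : W) : tens V W := (v2r v)^T *m v2r w.

Definition vbase V (i : 'I_(dim V)) : V := r2v (delta_mx 0 i).

Definition tlift_fun V W U (f : V -> W -> U) (z : tens V W) : U :=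
  \sum_i \sum_j z i j *: f (vbase i) (vbase j).

Fact tlift_fun_is_linear V W U (f : V -> W -> U) : linear (tlift_fun f).
Proof.
move=> c x y; rewrite /tlift_fun scaler_sumr -big_split /=.
apply: eq_bigr => i _; rewrite scaler_sumr -big_split /=.
by apply: eq_bigr => j _; rewrite !mxE scalerDl scalerA.
Qed.
HB.instance Definition _ V W U (f : V -> W -> U) :=
  GRing.isLinear.Build k (tens V W) U *:%R (tlift_fun f)
    (tlift_fun_is_linear f).

(* If f is bilinear, this is the linear map with v (x) w |-> f v w: see tliftE. *)
Definition tlift V W U (f : V -> W -> U) : 'Hom(tens V W, U) :=
  linfun (tlift_fun f).

Definition bilin V W U (f : V -> W -> U) :=
  (forall w, linear (f^~ w)) /\ (forall v, linear (f v)).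

Lemma vbase_sum V (v : V) : v = \sum_i v2r v 0 i *: vbase i.
Proof.
rewrite -{1}[v]v2rK {1}(row_sum_delta (v2r v)) linear_sum.
by apply: eq_bigr => i _; rewrite linearZ.
Qed.

Lemma linfunE V W (f : V -> W) (v : V) : linear f -> linfun f v = f v.
Proof.
move=> lf; pose l := GRing.isLinear.Build _ _ _ _ f lf.
pose F : {linear V -> W} := HB.pack f l.
exact: (lfunE F).
Qed.

Lemma linear_sumZ V W (f : V -> W) (I : Type) (r : seq I) c (v : I -> V) :
  linear f ->
  f (\sum_(i <- r) c i *: v i) = \sum_(i <- r) c i *: f (v i).
Proof.
move=> lf; pose l := GRing.isLinear.Build _ _ _ _ f lf.
pose F : {linear V -> W} := HB.pack f l.
rewrite -[f]/(F : V -> W) linear_sum; apply: eq_bigr => i _; exact: linearZ.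
Qed.

Lemma tliftE V W U (f : V -> W -> U) (v : V) (w : W) :
  bilin f -> tlift f (pure v w) = f v w.
Proof.
case=> fl fr; rewrite lfunE /= /tlift_fun {2}(vbase_sum v).
rewrite (linear_sumZ (f := f^~ w)) //; apply: eq_bigr => i _.
rewrite {2}(vbase_sum w) (linear_sumZ (f := f (vbase i))) // scaler_sumr.
by apply: eq_bigr => j _; rewrite mxE big_ord1 mxE scalerA.
Qed.

Lemma pure_bilin V W : bilin (@pure V W).
Proof.
split=> [w|v] c x y; rewrite /pure.
  by rewrite linearP /= linearP /= mulmxDl -scalemxAl.
by rewrite linearP /= linearP.
Qed.

Lemma tens_sum V W (z : tens V W) :
  z = \sum_i \sum_j z i j *: pure (vbase i) (vbase j).
Proof.
rewrite {1}[z]matrix_sum_delta; apply: eq_bigr => i _; apply: eq_bigr => j _.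
congr (_ *: _); rewrite /pure /vbase !r2vK; apply/matrixP=> a b.
by rewrite !mxE big_ord1 !mxE -natrM mulnb.
Qed.

Lemma tens_ind V W (P : tens V W -> Prop) :
  (forall v w, P (pure v w)) -> P 0 ->
  (forall c x y, P x -> P y -> P (c *: x + y)) -> forall z, P z.
Proof.
move=> Pp P0 PD z; rewrite (tens_sum z).
have PZ c x : P x -> P (c *: x) by move=> Px; rewrite -[_ *: _]addr0; apply: PD.
have PA x y : P x -> P y -> P (x + y).
  by move=> Px; rewrite -[x]scale1r; apply: PD.
apply: (big_ind P) => // i _; apply: (big_ind P) => // j _; exact: PZ.
Qed.

Lemma tens_ext V W U (f g : 'Hom(tens V W, U)) :
  (forall v w, f (pure v w) = g (pure v w)) -> f = g.
Proof.
move=> fg; apply/lfunP; elim/tens_ind => [//||c x y fx fy].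
  by rewrite !linear0.
by rewrite !linearP /= fx fy.
Qed.

Definition tmap (V V' W W' : vectType k) (f : 'Hom(V, V')) (g : 'Hom(W, W')) :
    'Hom(tens V W, tens V' W') :=
  tlift (fun v w => pure (f v) (g w)).

Definition tact (A B V V' W W' : vectType k) (f : 'Hom(A, 'Hom(V, V')))
    (g : 'Hom(B, 'Hom(W, W'))) :
    'Hom(tens A B, 'Hom(tens V W, tens V' W')) :=
  tlift (fun a b => tmap (f a) (g b)).

Definition tassoc U V W : 'Hom(tens (tens U V) W, tens U (tens V W)) :=
  tlift (fun z w => tlift (fun u v => pure u (pure v w)) z).

Definition tswap V W : 'Hom(tens V W, tens W V) := tlift (fun v w => pure w v).

Definition dual V : vectType k := 'Hom(V, k^o).

Definition tevl U V (f : dual U) : 'Hom(tens U V, V) :=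
  tlift (fun u v => (f u : k) *: v).
Definition tevr U V (f : dual V) : 'Hom(tens U V, U) :=
  tlift (fun u v => (f v : k) *: u).

Definition tens_fun V W (z : tens (dual V) W) : 'Hom(V, W) :=
  tlift (fun (g : dual V) w => linfun (fun v => (g v : k) *: w)) z.

Definition tensv V W (X : {vspace V}) (Y : {vspace W}) : {vspace tens V W} :=
  <<[seq pure x y | x <- vbasis X, y <- vbasis Y]>>%VS.

Definition quotv V (R : {vspace V}) : vectType k := subvs_of (R^C)%VS.
Definition qproj V (R : {vspace V}) : 'Hom(V, quotv R) :=
  linfun (vsproj (R^C)%VS \o daddv_pi (R^C)%VS R).

Lemma pureDl V W (w : W) : linear (fun v : V => pure v w).
Proof. exact: (pure_bilin V W).1. Qed.
Lemma pureDr V W (v : V) : linear (fun w : W => pure v w).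
Proof. exact: (pure_bilin V W).2. Qed.

Lemma pure0l V W (w : W) : pure (0 : V) w = 0.
Proof. by rewrite /pure linear0 trmx0 mul0mx. Qed.
Lemma pure0r V W (v : V) : pure v (0 : W) = 0.
Proof. by rewrite /pure linear0 mulmx0. Qed.
Lemma pureZl V W c (v : V) (w : W) : pure (c *: v) w = c *: pure v w.
Proof. by rewrite -[c *: v]addr0 pureDl pure0l addr0. Qed.
Lemma pureZr V W c (v : V) (w : W) : pure v (c *: w) = c *: pure v w.
Proof. by rewrite -[c *: w]addr0 pureDr pure0r addr0. Qed.

Lemma tmapE (V V' W W' : vectType k) (f : 'Hom(V, V')) (g : 'Hom(W, W')) v w :
  tmap f g (pure v w) = pure (f v) (g w).
Proof.
rewrite tliftE //; split=> [y|y] c x x'; first by rewrite linearP pureDl.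
by rewrite linearP pureDr.
Qed.

Lemma tmap_bilin (V V' W W' : vectType k) :
  bilin (fun (f : 'Hom(V, V')) (g : 'Hom(W, W')) => tmap f g).
Proof.
split=> [g|f] c x y; apply: tens_ext => v w; rewrite !(add_lfunE, scale_lfunE).
  by rewrite !tmapE !(add_lfunE, scale_lfunE) pureDl.
by rewrite !tmapE !(add_lfunE, scale_lfunE) pureDr.
Qed.

Lemma tmap0l (V V' W W' : vectType k) (g : 'Hom(W, W')) :
  tmap (0 : 'Hom(V, V')) g = 0.
Proof.
by apply: tens_ext => v w; rewrite tmapE !zero_lfunE pure0l.
Qed.

Lemma tactE (A B V V' W W' : vectType k) (f : 'Hom(A, 'Hom(V, V')))
    (g : 'Hom(B, 'Hom(W, W'))) a b :
  tact f g (pure a b) = tmap (f a) (g b).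
Proof.
rewrite tliftE //; split=> [y|y] c x x'; rewrite linearP.
  exact: (tmap_bilin _ _ _ _).1.
exact: (tmap_bilin _ _ _ _).2.
Qed.

Lemma tmap_comp (V1 V2 V3 W1 W2 W3 : vectType k) (f : 'Hom(V2, V3)) (f' : 'Hom(V1, V2))
    (g : 'Hom(W2, W3)) (g' : 'Hom(W1, W2)) :
  tmap (f \o f')%VF (g \o g')%VF = (tmap f g \o tmap f' g')%VF.
Proof. by apply: tens_ext => v w; rewrite comp_lfunE !tmapE !comp_lfunE. Qed.

Lemma tmap_id V W : tmap (\1%VF : 'End(V)) (\1%VF : 'End(W)) = \1%VF.
Proof. by apply: tens_ext => v w; rewrite tmapE !id_lfunE. Qed.

Lemma tassocE U V W (u : U) (v : V) (w : W) :
  tassoc U V W (pure (pure u v) w) = pure u (pure v w).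
Proof.
have bil w' : bilin (fun u v => pure u (pure v w')) :> Prop.
  split=> [y|y] c x x'; first by rewrite pureDl.
  by rewrite pureDl pureDr.
rewrite tliftE ?tliftE //; split=> [y|y] c x x'; first by rewrite linearP.
elim/tens_ind: y => [a b||d a b Ha Hb].
- by rewrite !tliftE // pureDr pureDr.
- by rewrite !linear0 ?scaler0 ?addr0.
by rewrite !linearP /= Ha Hb scalerDr addrACA.
Qed.

Lemma tswapE V W (v : V) (w : W) : tswap V W (pure v w) = pure w v.
Proof.
by rewrite tliftE //; split=> [y|y] c x x'; [rewrite pureDr|rewrite pureDl].
Qed.

Lemma tens_funE V W (f : dual V) (w : W) v :
  tens_fun (pure f w) v = (f v : k) *: w.
Proof.
have lin (g : dual V) (y : W) : linear (fun v => (g v : k) *: y).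
  by move=> c x x'; rewrite linearP scalerDl scalerA.
have linE (g : dual V) (y : W) (x : V) :
    linfun (fun v => (g v : k) *: y) x = (g x : k) *: y.
  exact/linfunE.
rewrite /tens_fun tliftE ?linE //; split=> [y|g] c x x'; apply/lfunP=> u.
  by rewrite !(add_lfunE, scale_lfunE) !linE !(add_lfunE, scale_lfunE)
             scalerDl scalerA.
by rewrite !(add_lfunE, scale_lfunE) !linE scalerDr !scalerA mulrC.
Qed.

Lemma tens_fun_linear V W : linear (@tens_fun V W).
Proof. by move=> c x y; rewrite /tens_fun linearP. Qed.

Lemma tens_fun_inj V W : injective (@tens_fun V W).
Proof.
pose co i : dual V := linfun (fun v : V => v2r v 0 i : k^o).
have coE i v : co i v = v2r v 0 i.
  by rewrite linfunE // => c x y; rewrite linearP /= !mxE.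
pose g (f : 'Hom(V, W)) : tens (dual V) W := \sum_i pure (co i) (f (vbase i)).
apply: (can_inj (g := g)) => z; elim/tens_ind: z => [f w||c x y Hx Hy].
- rewrite /g; have fE : f = \sum_i (f (vbase i) : k) *: co i.
    apply/lfunP=> v; rewrite sum_lfunE {1}(vbase_sum v) linear_sum.
    by apply: eq_bigr => i _; rewrite linearZ scale_lfunE coE /= [RHS]mulrC.
  rewrite {2}fE (linear_sumZ (f := fun f' => pure f' w)); last exact: pureDl.
  apply: eq_bigr => i _; rewrite tens_funE.
  exact: pureZr.
- rewrite /g big1 // => i _; rewrite /tens_fun linear0 zero_lfunE.
  by rewrite pure0r.
rewrite tens_fun_linear -{2}Hx -{2}Hy /g scaler_sumr -big_split /=.
by apply: eq_bigr => i _; rewrite add_lfunE scale_lfunE pureDr.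
Qed.

Lemma lker_qproj V (R : {vspace V}) : lker (qproj R) = R.
Proof.
have dir : (R^C :&: R)%VS = 0%VS by rewrite capvC capv_compl.
apply/vspaceP=> v; rewrite memv_ker lfunE /=.
have pi_in : daddv_pi (R^C)%VS R v \in (R^C)%VS by apply: memv_pi.
have vE : daddv_pi (R^C)%VS R v + daddv_pi R (R^C)%VS v = v.
  by apply: daddv_pi_add => //; rewrite addvC addv_complf memvf.
apply/eqP/idP => [v0|vR].
  have d0 : daddv_pi (R^C)%VS R v = 0 by rewrite -(vsprojK pi_in) v0 linear0.
  by rewrite -vE d0 add0r; apply: memv_pi.
suff : daddv_pi (R^C)%VS R v \in (R^C :&: R)%VS.
  by rewrite dir memv0 => /eqP->; rewrite linear0.
rewrite memv_cap pi_in /=.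
have -> : daddv_pi (R^C)%VS R v = v - daddv_pi R (R^C)%VS v.
  by rewrite -{2}vE addrK.
by rewrite memvB // memv_pi.
Qed.

Lemma limg_qproj V (R : {vspace V}) : limg (qproj R) = fullv.
Proof.
have dir : (R^C :&: R)%VS = 0%VS by rewrite capvC capv_compl.
apply/vspaceP=> u; rewrite memvf; apply/memv_imgP.
exists (vsval u); rewrite ?memvf // lfunE /= daddv_pi_id ?subvsP //.
by rewrite vsvalK.
Qed.

End Tensor.

Notation "v \ox w" := (pure v w) (at level 35, right associativity) : ring_scope.

Section TensorAlgebra.
Variables (k : fieldType).
Implicit Types A B : falgType k.

Definition lmul A : 'Hom(A, 'End(A)) := linfun (@amull k A).
Definition rmul A : 'Hom(A, 'End(A)) := linfun (@amulr k A).

Lemma lmulE A (a b : A) : lmul A a b = a * b.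
Proof. by rewrite lfunE /= lfunE. Qed.
Lemma rmulE A (a b : A) : rmul A a b = b * a.
Proof. by rewrite lfunE /= lfunE. Qed.

Section Instance.
Variables A B : falgType k.

Definition tmul (z z' : tens A B) : tens A B :=
  tact (lmul A) (lmul B) z z'.

Lemma tmulE a b a' b' :
  tmul (a \ox b) (a' \ox b') = (a * a') \ox (b * b').
Proof. by rewrite /tmul tactE tmapE !lmulE. Qed.

Lemma tmulPl c x y z : tmul (c *: x + y) z = c *: tmul x z + tmul y z.
Proof. by rewrite /tmul linearP add_lfunE scale_lfunE. Qed.
Lemma tmulPr c x y z : tmul z (c *: x + y) = c *: tmul z x + tmul z y.
Proof. by rewrite /tmul linearP. Qed.
Lemma tmul0l z : tmul 0 z = 0.
Proof. by rewrite /tmul linear0 zero_lfunE. Qed.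
Lemma tmul0r z : tmul z 0 = 0. Proof. by rewrite /tmul linear0. Qed.

Lemma tmulA : associative tmul.
Proof.
elim/tens_ind => [a b||c x x' Hx Hx'] y z; first last.
- by rewrite !tmulPl Hx Hx'.
- by rewrite !tmul0l.
elim/tens_ind: y => [a' b'||c x x' Hx Hx']; first last.
- by rewrite !(tmulPl, tmulPr) Hx Hx'.
- by rewrite !(tmul0l, tmul0r).
elim/tens_ind: z => [a'' b''||c x x' Hx Hx']; first last.
- by rewrite !tmulPr Hx Hx'.
- by rewrite !tmul0r.
by rewrite !tmulE !mulrA.
Qed.

Lemma tmul1l : left_id (1 \ox 1) tmul.
Proof.
elim/tens_ind => [a b||c x x' Hx Hx']; first by rewrite tmulE !mul1r.
  by rewrite tmul0r.
by rewrite tmulPr Hx Hx'.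
Qed.

Lemma tmul1r : right_id (1 \ox 1) tmul.
Proof.
elim/tens_ind => [a b||c x x' Hx Hx']; first by rewrite tmulE !mulr1.
  by rewrite tmul0l.
by rewrite tmulPl Hx Hx'.
Qed.

Lemma tmulDl : left_distributive tmul +%R.
Proof. by move=> x y z; rewrite -{1}[x]scale1r tmulPl scale1r. Qed.
Lemma tmulDr : right_distributive tmul +%R.
Proof. by move=> x y z; rewrite -{1}[y]scale1r tmulPr scale1r. Qed.

Lemma pure_neq0 (a : A) (b : B) : a != 0 -> b != 0 -> a \ox b != 0.
Proof.
move=> a0 b0; apply/eqP=> ab0.
have va0 : v2r a != 0 by rewrite -(inj_eq (can_inj r2vK)) v2rK linear0.
have vb0 : v2r b != 0 by rewrite -(inj_eq (can_inj r2vK)) v2rK linear0.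
have [i ai] := rV0Pn _ va0; have [j bj] := rV0Pn _ vb0.
have /matrixP/(_ i j)/eqP := ab0; rewrite !mxE big_ord1 !mxE mulf_eq0.
by rewrite (negbTE ai) (negbTE bj).
Qed.

Lemma tone_neq0 : (1 \ox 1 : tens A B) != 0.
Proof. by rewrite pure_neq0 ?oner_neq0. Qed.

HB.instance Definition _ := GRing.Zmodule_isNzRing.Build (tens A B)
  tmulA tmul1l tmul1r tmulDl tmulDr tone_neq0.

Fact tmul_scaleAl (c : k) (x y : tens A B) : c *: (x * y) = c *: x * y.
Proof. by have := tmulPl c x 0 y; rewrite addr0 tmul0l addr0. Qed.
HB.instance Definition _ := GRing.Lmodule_isLalgebra.Build k (tens A B)
  tmul_scaleAl.
Fact tmul_scaleAr (c : k) (x y : tens A B) : c *: (x * y) = x * (c *: y).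
Proof. by have := tmulPr c y 0 x; rewrite addr0 tmul0r addr0. Qed.
HB.instance Definition _ := GRing.Lalgebra_isAlgebra.Build k (tens A B)
  tmul_scaleAr.
HB.instance Definition _ := Algebra_isFalgebra.Build k (tens A B).

Lemma pureM (a a' : A) (b b' : B) :
  (a \ox b) * (a' \ox b') = (a * a') \ox (b * b').
Proof. exact: tmulE. Qed.

End Instance.
End TensorAlgebra.

Lemma tens1E (k : fieldType) (A B : falgType k) : (1 : tens A B) = 1 \ox 1.
Proof. by []. Qed.

(* The character group of a finite group, with values in k. *)
Section Characters.
Variables (k : closedFieldType) (gT : finGroupType).

Definition is_chr (f : {ffun gT -> k}) : bool :=
  (f 1%g == 1) && [forall a, forall b, f (a * b)%g == f a * f b].

Record chr := Chr { chr_val :> {ffun gT -> k}; _ : is_chr chr_val }.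
HB.instance Definition _ := [isSub for chr_val].
HB.instance Definition _ := [Choice of chr by <:].

Lemma chr1 (f : chr) : f 1%g = 1.
Proof. by case: f => f /= /andP[/eqP]. Qed.
Lemma chrM (f : chr) a b : f (a * b)%g = f a * f b.
Proof. by case: f => f /= /andP[_ /forallP/(_ a)/forallP/(_ b)/eqP]. Qed.
Lemma chrX (f : chr) a n : f (a ^+ n)%g = f a ^+ n.
Proof. by elim: n => [|n IH]; rewrite ?chr1 // expgS exprS chrM IH. Qed.
Lemma chr_neq0 (f : chr) a : f a != 0.
Proof.
apply: contraTneq (oner_neq0 k) => fa0.
by rewrite -(chr1 f) -(mulgV a) chrM fa0 mul0r eqxx.
Qed.
Lemma chrV (f : chr) a : f a^-1%g = (f a)^-1.
Proof. by apply: (mulfI (chr_neq0 f a)); rewrite -chrM mulgV chr1 divff ?chr_neq0. Qed.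

Let roots : seq k :=
  sval (closed_field_poly_normal ('X^#|gT| - 1 : {poly k})).

Lemma chr_root (f : chr) a : f a \in roots.
Proof.
rewrite /roots; case: closed_field_poly_normal => r /= rE.
have p0 : 'X^#|gT| - 1 != 0 :> {poly k}.
  by rewrite monic_neq0 // monicXnsubC // -cardsT cardG_gt0.
have : root ('X^#|gT| - 1) (f a).
  rewrite rootE !hornerE -chrX -cardsT.
  by rewrite expg_cardG ?inE // chr1 subrr.
by rewrite rE rootZ ?root_prod_XsubC // lead_coef_eq0.
Qed.

Let chr_of (g : {ffun gT -> seq_sub roots}) : option chr :=
  insub [ffun a => ssval (g a)].
Let of_chr (f : chr) : {ffun gT -> seq_sub roots} :=
  [ffun a => SeqSub (chr_root f a)].
Fact of_chrK : pcancel of_chr chr_of.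
Proof.
move=> f; rewrite /chr_of.
have -> : [ffun a => ssval (of_chr f a)] = val f.
  by apply/ffunP=> a; rewrite !ffunE.
by rewrite valK.
Qed.
HB.instance Definition _ := Countable.copy chr (pcan_type of_chrK).
HB.instance Definition _ : isFinite chr := PCanIsFinite of_chrK.

Fact chr_one_subproof : is_chr [ffun=> 1].
Proof.
rewrite /is_chr ffunE eqxx; apply/forallP=> a; apply/forallP=> b.
by rewrite !ffunE mul1r.
Qed.
Fact chr_mul_subproof (f g : chr) : is_chr [ffun a => f a * g a].
Proof.
rewrite /is_chr ffunE !chr1 mul1r eqxx; apply/forallP=> a; apply/forallP=> b.
by rewrite !ffunE !chrM mulrACA.
Qed.
Fact chr_inv_subproof (f : chr) : is_chr [ffun a => (f a)^-1].
Proof.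
rewrite /is_chr ffunE !chr1 invr1 eqxx; apply/forallP=> a; apply/forallP=> b.
by rewrite !ffunE !chrM invfM.
Qed.
Definition chr_one := Chr chr_one_subproof.
Definition chr_mul f g := Chr (chr_mul_subproof f g).
Definition chr_inv f := Chr (chr_inv_subproof f).

Fact chr_mulA : associative chr_mul.
Proof. by move=> f g h; apply/val_inj/ffunP=> a; rewrite /= !ffunE mulrA. Qed.
Fact chr_mul1 : left_id chr_one chr_mul.
Proof. by move=> f; apply/val_inj/ffunP=> a; rewrite !ffunE /= mul1r. Qed.
Fact chr_mulV : left_inverse chr_one chr_inv chr_mul.
Proof.
by move=> f; apply/val_inj/ffunP=> a; rewrite !ffunE /= mulVf ?chr_neq0.
Qed.
HB.instance Definition _ := Finite_isGroup.Build chr chr_mulA chr_mul1 chr_mulV.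

Lemma chr_groupE (f g : chr) a :
  ((f * g)%g a = f a * g a) * (f^-1%g a = (f a)^-1) * ((1%g : chr) a = 1).
Proof. by rewrite /= !ffunE. Qed.

End Characters.

Section Modules.
Variables (k : fieldType) (B : falgType k).

Record lrep := LRep {
  lrep_sort :> vectType k;
  lact : 'Hom(B, 'End(lrep_sort));
  lact1 : lact 1 = \1%VF;
  lactM : forall a b, lact (a * b) = (lact a \o lact b)%VF }.

Definition submod (M : lrep) (U : {vspace M}) : Prop :=
  forall b u, u \in U -> lact M b u \in U.

Definition simple_submod (M : lrep) (U : {vspace M}) : Prop :=
  [/\ submod U, U <> 0%VS
    & forall U' : {vspace M}, submod U' -> (U' <= U)%VS -> U' = 0%VS \/ U' = U].

Definition irreducible_mod (M : lrep) : Prop := simple_submod (@fullv k M).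

Definition semisimple_mod (M : lrep) : Prop :=
  exists (n : nat) (U : 'I_n -> {vspace M}),
    [/\ forall i, simple_submod (U i), directv (\sum_i U i)
      & (\sum_i U i)%VS = fullv].

Definition mod_iso (M N : lrep) (f : 'Hom(M, N)) : Prop :=
  [/\ lker f = 0%VS, limg f = fullv
    & forall b x, f (lact M b x) = lact N b (f x)].

Fact lmul1_subproof : lmul B 1 = \1%VF.
Proof. by apply/lfunP=> x; rewrite lmulE id_lfunE mul1r. Qed.
Fact lmulM_subproof a b : lmul B (a * b) = (lmul B a \o lmul B b)%VF.
Proof. by apply/lfunP=> x; rewrite comp_lfunE !lmulE mulrA. Qed.
Definition reg_mod : lrep := LRep lmul1_subproof lmulM_subproof.

Definition semisimple_alg : Prop := semisimple_mod reg_mod.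

Section Submodule.
Variables (M : lrep) (U : {vspace M}).

Definition sub_act_at (b : B) : 'End(subvs_of U) :=
  (linfun (vsproj U) \o lact M b \o linfun vsval)%VF.
Lemma sub_act_atE b u : sub_act_at b u = vsproj U (lact M b (vsval u)).
Proof. by rewrite /sub_act_at !comp_lfunE !lfunE. Qed.

Fact sub_act_linear : linear sub_act_at.
Proof.
move=> c x y; apply/lfunP=> u.
by rewrite !(add_lfunE, scale_lfunE) !sub_act_atE linearP add_lfunE scale_lfunE
           linearP.
Qed.
Definition sub_act : 'Hom(B, 'End(subvs_of U)) := linfun sub_act_at.
Lemma sub_actE b u : sub_act b u = vsproj U (lact M b (vsval u)).
Proof. by rewrite linfunE ?sub_act_atE //; apply: sub_act_linear. Qed.

Hypothesis Ust : submod U.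
Fact sub_act1 : sub_act 1 = \1%VF.
Proof. by apply/lfunP=> u; rewrite sub_actE lact1 !id_lfunE vsvalK. Qed.
Fact sub_actM a b : sub_act (a * b) = (sub_act a \o sub_act b)%VF.
Proof.
apply/lfunP=> u; rewrite comp_lfunE !sub_actE lactM comp_lfunE vsprojK //.
exact/Ust/subvsP.
Qed.
Definition sub_mod : lrep := LRep sub_act1 sub_actM.
End Submodule.

Section Intertwiners.
Variables (R M N : vectType k) (r : 'Hom(R, 'End(M))) (s : 'Hom(R, 'End(N))).

Definition defect_at (f : 'Hom(M, N)) (x : R) : 'Hom(M, N) :=
  (f \o r x)%VF - (s x \o f)%VF.
Definition defect (f : 'Hom(M, N)) : 'Hom(R, 'Hom(M, N)) :=
  linfun (defect_at f).
Definition homs : {vspace 'Hom(M, N)} := lker (linfun defect).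

Fact defectE f x : defect f x = (f \o r x)%VF - (s x \o f)%VF.
Proof.
rewrite linfunE // => c a b; apply/lfunP=> v.
rewrite /defect_at !linearP /=.
rewrite !(comp_lfunE, add_lfunE, opp_lfunE, scale_lfunE) linearP /=.
by rewrite scalerBr opprD addrACA.
Qed.

Lemma homsP f :
  reflect (forall x, (f \o r x)%VF = (s x \o f)%VF) (f \in homs).
Proof.
rewrite memv_ker linfunE; last first.
  move=> c g h; apply/lfunP=> x; rewrite !(add_lfunE, scale_lfunE) !defectE.
  apply/lfunP=> v.
  rewrite !(comp_lfunE, add_lfunE, opp_lfunE, scale_lfunE) linearP /=.
  by rewrite !scalerBr opprD addrACA.
apply: (iffP eqP) => [f0 x|fP].
  by apply/eqP; rewrite -subr_eq0 -defectE f0 zero_lfunE.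
by apply/lfunP=> x; rewrite defectE fP subrr zero_lfunE.
Qed.
End Intertwiners.

Section ModTens.
Variables (M : lrep) (U : vectType k).
Definition mod_tens_at (b : B) : 'End(tens M U) := tmap (lact M b) \1.
Definition mod_tens_act : 'Hom(B, 'End(tens M U)) := linfun mod_tens_at.
Lemma mod_tens_actE b : mod_tens_act b = tmap (lact M b) \1.
Proof.
rewrite linfunE // => c x y; rewrite /mod_tens_at linearP.
exact: (tmap_bilin _ _ _ _).1.
Qed.
Fact mod_tens_act1 : mod_tens_act 1 = \1%VF.
Proof. by rewrite mod_tens_actE lact1 tmap_id. Qed.
Fact mod_tens_actM a b :
  mod_tens_act (a * b) = (mod_tens_act a \o mod_tens_act b)%VF.
Proof. by rewrite !mod_tens_actE lactM -tmap_comp comp_lfun1l. Qed.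
(* M (x) U with B acting on the left factor *)
Definition mod_tens : lrep := LRep mod_tens_act1 mod_tens_actM.
End ModTens.

End Modules.

Section Hopf.
Variable k : closedFieldType.

Record hopfAlg := HopfAlg {
  hopf_sort :> falgType k;
  cop : 'AHom(hopf_sort, tens hopf_sort hopf_sort);
  cou : 'AHom(hopf_sort, k^o);
  apd : 'End(hopf_sort);
  copA : forall h, tassoc _ _ _ (tmap cop \1 (cop h)) = tmap \1 cop (cop h);
  couL : forall h, tevl _ cou (cop h) = h;
  couR : forall h, tevr _ cou (cop h) = h;
  apdL : forall h, tlift (fun x y => apd x * y) (cop h) = (cou h : k) *: 1;
  apdR : forall h, tlift (fun x y => x * apd y) (cop h) = (cou h : k) *: 1 }.

Variable H : hopfAlg.

(* A finite abelian subgroup of G(H), as an embedded finite group. *)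
Record grouplike_sub := GrouplikeSub {
  gl_sort :> finGroupType;
  gl_abelian : abelian [set: gl_sort];
  gl : gl_sort -> H;
  gl_inj : injective gl;
  gl1 : gl 1%g = 1;
  glM : forall a b, gl (a * b)%g = gl a * gl b;
  cop_gl : forall a, cop H (gl a) = gl a \ox gl a;
  cou_gl : forall a, cou H (gl a) = 1 }.

(* The antipode of a finite-dimensional Hopf algebra is bijective, so the
   inverse linear function is its genuine inverse. *)
Definition apdV : 'End(H) := (apd H)^-1%VF.

Section TensorModule.
Variables X Y : lrep H.

Definition tens_act : 'Hom(H, 'End(tens X Y)) :=
  (tact (lact X) (lact Y) \o cop H)%VF.

Lemma tact_mul (a b : tens H H) :
  tact (lact X) (lact Y) (a * b)
    = (tact (lact X) (lact Y) a \o tact (lact X) (lact Y) b)%VF.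
Proof.
elim/tens_ind: a => [a a'||c x x' Hx Hx']; first last.
- rewrite mulrDl -scalerAl !linearP /= Hx Hx'.
  by rewrite comp_lfunDl comp_lfunZl.
- by rewrite mul0r !linear0 comp_lfun0l.
elim/tens_ind: b => [b b'||c x x' Hx Hx']; first last.
- rewrite mulrDr -scalerAr !linearP /= Hx Hx'.
  by rewrite comp_lfunDr comp_lfunZr.
- by rewrite mulr0 !linear0 comp_lfun0r.
by rewrite pureM !tactE !lactM tmap_comp.
Qed.

Fact tens_act1 : tens_act 1 = \1%VF.
Proof. by rewrite comp_lfunE rmorph1 tens1E tactE !lact1 tmap_id. Qed.
Fact tens_actM a b : tens_act (a * b) = (tens_act a \o tens_act b)%VF.
Proof. by rewrite !comp_lfunE rmorphM tact_mul. Qed.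
Definition tens_mod : lrep H := LRep tens_act1 tens_actM.
End TensorModule.

(* The algebra H^* with its convolution product. *)
Definition conv (f g : dual H) : dual H :=
  (tlift (fun x y => (f x : k^o) * g y : k^o) \o cop H)%VF.
Definition convl (f : dual H) : 'End(dual H) := linfun (conv f).

Definition rtrans_at (h : H) : 'End(dual H) :=
  linfun (fun f : dual H => (f \o amulr h)%VF).
Lemma rtrans_atE h (f : dual H) t : rtrans_at h f t = f (t * h).
Proof.
rewrite linfunE ?comp_lfunE ?lfunE // => c x y.
by rewrite comp_lfunDl comp_lfunZl.
Qed.
Definition rtrans : 'Hom(H, 'End(dual H)) := linfun rtrans_at.
Lemma rtransE h (f : dual H) t : rtrans h f t = f (t * h).
Proof.
rewrite linfunE ?rtrans_atE // => c x y; apply/lfunP=> g; apply/lfunP=> u.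
rewrite !(add_lfunE, scale_lfunE) !rtrans_atE mulrDr -scalerAr linearP.
by [].
Qed.
Fact rtrans1 : rtrans 1 = \1%VF.
Proof. by apply/lfunP=> f; apply/lfunP=> t; rewrite rtransE mulr1 id_lfunE. Qed.
Fact rtransM a b : rtrans (a * b) = (rtrans a \o rtrans b)%VF.
Proof.
by apply/lfunP=> f; apply/lfunP=> t; rewrite comp_lfunE !rtransE mulrA.
Qed.
(* H^* with (h . f)(t) = f (t h) *)
Definition dual_mod : lrep H := LRep rtrans1 rtransM.

(* h -| f, with (h -| f)(t) = f (S^-1(h) t) *)
Definition harp_at (h : H) : 'End(dual H) :=
  linfun (fun f : dual H => (f \o amull (apdV h))%VF).
Definition harp : 'Hom(H, 'End(dual H)) := linfun harp_at.
Lemma harpE h (f : dual H) t : harp h f t = f (apdV h * t).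
Proof.
have atE u g x : harp_at u g x = g (apdV u * x).
  rewrite linfunE ?comp_lfunE ?lfunE // => c y z.
  by rewrite comp_lfunDl comp_lfunZl.
rewrite linfunE ?atE // => c x y; apply/lfunP=> g; apply/lfunP=> u.
rewrite !(add_lfunE, scale_lfunE) !atE linearP mulrDl -scalerAl linearP.
by [].
Qed.


Section Convolution.
Lemma tpairE (f g : dual H) x y :
  tlift (fun x y => (f x : k^o) * g y : k^o) (x \ox y) = (f x : k^o) * g y.
Proof.
rewrite tliftE //; split=> [v|v] c a b.
  by rewrite linearP mulrDl -scalerAl.
by rewrite linearP mulrDr -scalerAr.
Qed.

Lemma conv_linearr (f : dual H) : linear (conv f).
Proof.
move=> c x y; apply/lfunP=> h; rewrite !(add_lfunE, scale_lfunE).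
rewrite /conv !comp_lfunE; elim/tens_ind: (cop H h) => [a b||d a b Ha Hb].
- by rewrite !tpairE !(add_lfunE, scale_lfunE) mulrDr -scalerAr.
- by rewrite !linear0 ?scaler0 ?addr0.
by rewrite !linearP /= Ha Hb !scalerDr addrACA !scalerA mulrC.
Qed.

Lemma conv_linearl (g : dual H) : linear (conv^~ g).
Proof.
move=> c x y; apply/lfunP=> h; rewrite !(add_lfunE, scale_lfunE).
rewrite /conv !comp_lfunE; elim/tens_ind: (cop H h) => [a b||d a b Ha Hb].
- by rewrite !tpairE !(add_lfunE, scale_lfunE) mulrDl -scalerAl.
- by rewrite !linear0 ?scaler0 ?addr0.
by rewrite !linearP /= Ha Hb !scalerDr addrACA !scalerA mulrC.
Qed.

Lemma convlE (f g : dual H) : convl f g = conv f g.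
Proof. by rewrite linfunE //; apply: conv_linearr. Qed.

Lemma convl_linear : linear convl.
Proof.
move=> c x y; apply/lfunP=> g; rewrite add_lfunE scale_lfunE !convlE.
exact: conv_linearl.
Qed.
End Convolution.


Section Comodules.

Record comodAlg := ComodAlg {
  comod_sort :> falgType k;
  coact : 'AHom(comod_sort, tens H comod_sort);
  coactA : forall x,
    tassoc _ _ _ (tmap (cop H) \1 (coact x)) = tmap \1 coact (coact x);
  coact_cou : forall x, tevl _ (cou H) (coact x) = x }.

Definition Hsimple (K : comodAlg) : Prop :=
  forall I : {vspace K},
    (forall x y, y \in I -> x * y \in I /\ y * x \in I) ->
    (forall y, y \in I -> coact K y \in tensv fullv I) ->
  I = 0%VS \/ I = fullv.

Definition coinvariant (K : comodAlg) (x : K) : Prop := coact K x = 1 \ox x.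

End Comodules.

Section Stabilizer.
Variables (K : comodAlg) (V W : lrep K).

Definition Lmap : 'Hom(tens (dual H) 'Hom(V, W),
                       'Hom(tens (dual H) V, tens (dual H) W)) :=
  tlift (fun f T => tmap (convl f) T).

Lemma LmapE f T : Lmap (f \ox T) = tmap (convl f) T.
Proof.
rewrite tliftE //; split=> [S|g] c x y; last exact: (tmap_bilin _ _ _ _).2.
by rewrite convl_linear; apply: (tmap_bilin _ _ _ _).1.
Qed.
End Stabilizer.

(* k . (f (x) v) = (k_(-1) -| f) (x) k_(0) v *)
Definition harp_act (K : comodAlg) (V : lrep K) :
    'Hom(K, 'End(tens (dual H) V)) :=
  (tact harp (lact V) \o coact K)%VF.

(* Stab_K(V, W), pulled back along the injection Lmap: see mem_stab, Lmap_inj. *)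
Definition stab (K : comodAlg) (V W : lrep K) :
    {vspace tens (dual H) 'Hom(V, W)} :=
  (Lmap V W @^-1: homs (harp_act V) (harp_act W))%VS.

Lemma mem_stab (K : comodAlg) (V W : lrep K) z :
  (z \in stab V W) = (Lmap V W z \in homs (harp_act V) (harp_act W)).
Proof. exact/esym/memv_preim. Qed.

Lemma Lmap_stab (K : comodAlg) (V W : lrep K) :
  (Lmap V W @: stab V W
     = homs (harp_act V) (harp_act W) :&: limg (Lmap V W))%VS.
Proof.
apply/vspaceP=> F; apply/memv_imgP/idP => [[z zS ->]|].
  by rewrite memv_cap -mem_stab zS memv_img ?memvf.
rewrite memv_cap => /andP[FK /memv_imgP[z _ Fz]].
by exists z; rewrite // mem_stab -Fz.
Qed.

Lemma Lmap_inj (K : comodAlg) (V W : lrep K) : lker (Lmap V W) = 0%VS.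
Proof.
have LE z v t : tens_fun (Lmap V W z (ahval (cou H) \ox v)) t = tens_fun z t v.
  elim/tens_ind: z => [f T||c x y Hx Hy].
  - rewrite LmapE tmapE !tens_funE scale_lfunE; congr (_ *: _).
    rewrite convlE /conv comp_lfunE -{2}[t](couR t).
    elim/tens_ind: (cop H t) => [a b||c x y Hx Hy].
    + rewrite tpairE /tevr tliftE; first by rewrite linearZ mulrC.
      split=> [d|d] c x y; first by rewrite scalerDr !scalerA mulrC.
      by rewrite linearP scalerDl scalerA.
    + by rewrite !linear0.
    by rewrite !linearP /= Hx Hy.
  - by rewrite !linear0 zero_lfunE /tens_fun !linear0 !zero_lfunE.
  rewrite linearP add_lfunE scale_lfunE !tens_fun_linear.
  by rewrite !(add_lfunE, scale_lfunE) Hx Hy.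
apply/eqP/lker0P => x y /lfunP xy; apply: tens_fun_inj.
by apply/lfunP=> t; apply/lfunP=> v; rewrite -!LE xy.
Qed.

(* The translates of Stab_K(V, W) stay in Stab_K(V, W), because
   L(h . z) = (h_1 (x) id) L(z) (S(h_2) (x) id). *)
Section Stability.
Variables (K : comodAlg) (V W : lrep K).

Let shift (a b : H) : tens H H := cop H a * (1 \ox apd H b).
Let shift_bilin : bilin shift.
Proof.
split=> [v|v] c x y; rewrite /shift; first by rewrite linearP mulrDl -scalerAl.
by rewrite linearP pureDr mulrDr -scalerAr.
Qed.

Lemma shift_cop h : tlift shift (cop H h) = h \ox 1.
Proof.
pose mS : 'Hom(tens H H, H) := tlift (fun x y => x * apd H y).
have mSE x y : mS (x \ox y) = x * apd H y.
  rewrite tliftE //; split=> [v|v] c a b; first by rewrite mulrDl -scalerAl.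
  by rewrite linearP mulrDr -scalerAr.
have sE z : tlift shift z = tmap \1 mS (tassoc _ _ _ (tmap (cop H) \1 z)).
  elim/tens_ind: z => [a b||c x y Hx Hy]; last by rewrite !linearP /= Hx Hy.
    rewrite tliftE // tmapE id_lfunE /shift.
    elim/tens_ind: (cop H a) => [x y||c x y Hx Hy].
    - by rewrite tassocE tmapE mSE id_lfunE pureM mulr1.
    - by rewrite mul0r pure0l !linear0.
    by rewrite mulrDl -scalerAl pureDl !linearP /= Hx Hy.
  by rewrite !linear0.
rewrite sE copA -[in RHS](couR h).
elim/tens_ind: (cop H h) => [a b||c x y Hx Hy].
- rewrite !tmapE !id_lfunE apdR /tevr tliftE; first by rewrite pureZl pureZr.
  split=> [d|d] c x y; first by rewrite scalerDr !scalerA mulrC.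
  by rewrite linearP scalerDl scalerA.
- by rewrite !linear0 pure0l.
by rewrite !linearP /= Hx Hy pureDl.
Qed.

Let wrap (f : dual H) (a b : H) : 'End(dual H) :=
  (rtrans a \o convl f \o rtrans (apd H b))%VF.

Let wrap_bilin f : bilin (wrap f).
Proof.
split=> [v|v] c x y; rewrite /wrap !linearP /=.
  by rewrite !comp_lfunDl -!comp_lfunZl.
by rewrite !comp_lfunDr -!comp_lfunZr.
Qed.

Let pair (f g : dual H) : 'Hom(tens H H, k^o) :=
  tlift (fun x y => (f x : k^o) * g y : k^o).

Let pair_wrap f g t z :
  tlift (wrap f) z g t = pair f g (cop H t * tlift shift z).
Proof.
elim/tens_ind: z => [a b||c x y Hx Hy].
- rewrite !tliftE // /wrap !comp_lfunE rtransE convlE /conv comp_lfunE.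
  rewrite /shift rmorphM /= mulrA.
  elim/tens_ind: (cop H t * cop H a) => [x y||c x y Hx Hy].
  + by rewrite pureM mulr1 /pair !tpairE rtransE.
  + by rewrite mul0r !linear0.
  by rewrite mulrDl -scalerAl !linearP /= Hx Hy.
- by rewrite !linear0 mulr0 linear0 !zero_lfunE.
by rewrite !linearP !(add_lfunE, scale_lfunE) Hx Hy mulrDr -scalerAr linearP.
Qed.

Lemma wrap_cop h f : tlift (wrap f) (cop H h) = convl (rtrans h f).
Proof.
apply/lfunP=> g; apply/lfunP=> t; rewrite pair_wrap shift_cop convlE.
rewrite /conv comp_lfunE; elim/tens_ind: (cop H t) => [x y||c x y Hx Hy].
- by rewrite pureM mulr1 /pair !tpairE rtransE.
- by rewrite mul0r !linear0.
by rewrite mulrDl -scalerAl !linearP /= Hx Hy.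
Qed.

Let wrapL (F : 'Hom(tens (dual H) V, tens (dual H) W)) (a b : H) :=
  (tmap (rtrans a) \1 \o F \o tmap (rtrans (apd H b)) \1)%VF.

Let wrapL_bilin F : bilin (wrapL F).
Proof.
split=> [v|v] c x y; rewrite /wrapL !linearP /= (tmap_bilin _ _ _ _).1.
  by rewrite !comp_lfunDl -!comp_lfunZl.
by rewrite !comp_lfunDr -!comp_lfunZr.
Qed.

Let wrapL_Lmap z w :
  tlift (wrapL (Lmap V W z)) w =
  tlift (fun f T => tmap (tlift (wrap f) w) T) z.
Proof.
have bil : bilin (fun f (T : 'Hom(V, W)) => tmap (tlift (wrap f) w) T).
  split=> [T|f] c x y; last exact: (tmap_bilin _ _ _ _).2.
  rewrite -(tmap_bilin _ _ _ _).1; congr (tmap _ T).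
  elim/tens_ind: w => [a b||d a b Ha Hb].
  - rewrite !tliftE // /wrap convl_linear.
    by rewrite !(comp_lfunDl, comp_lfunDr) -!(comp_lfunZl, comp_lfunZr).
  - by rewrite !linear0 ?scaler0 ?addr0.
  by rewrite !linearP /= Ha Hb !scalerDr addrACA !scalerA mulrC.
elim/tens_ind: z => [f T||c x y Hx Hy].
- rewrite LmapE tliftE // => {bil}.
  elim/tens_ind: w => [a b||d a b Ha Hb].
  + by rewrite !tliftE // /wrapL -!tmap_comp comp_lfun1l comp_lfun1r.
  + by rewrite !linear0 tmap0l.
  by rewrite !linearP /= Ha Hb (tmap_bilin _ _ _ _).1.
- suff -> : tlift (wrapL (Lmap V W 0)) = 0 by rewrite linear0 zero_lfunE.
  apply: tens_ext => a b; rewrite tliftE // /wrapL linear0 zero_lfunE.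
  by rewrite comp_lfun0r comp_lfun0l.
rewrite !linearP /= -Hx -Hy => {bil Hx Hy}.
elim/tens_ind: w => [a b||d a b Ha Hb].
- rewrite !tliftE // /wrapL.
  by rewrite !(comp_lfunDl, comp_lfunDr) -!(comp_lfunZl, comp_lfunZr).
- by rewrite !linear0 ?scaler0 ?addr0.
by rewrite !linearP /= Ha Hb !scalerDr addrACA !scalerA mulrC.
Qed.

Lemma Lmap_shift h z :
  Lmap V W (tmap (rtrans h) \1 z) = tlift (wrapL (Lmap V W z)) (cop H h).
Proof.
rewrite wrapL_Lmap; elim/tens_ind: z => [f T||c x y Hx Hy].
- rewrite tmapE LmapE id_lfunE tliftE ?wrap_cop //.
  split=> [S|g] c x y; last exact: (tmap_bilin _ _ _ _).2.
  by rewrite !wrap_cop linearP convl_linear (tmap_bilin _ _ _ _).1.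
- by rewrite !linear0.
by rewrite !linearP /= Hx Hy.
Qed.

Let rtrans_harp (U : lrep K) a x :
  (tmap (rtrans a) \1 \o harp_act U x)%VF
    = (harp_act U x \o tmap (rtrans a) \1)%VF.
Proof.
rewrite /harp_act comp_lfunE; elim/tens_ind: (coact K x) => [h y||c y z Hy Hz].
- rewrite tactE -!tmap_comp comp_lfun1l comp_lfun1r; congr (tmap _ _).
  apply/lfunP=> f; apply/lfunP=> t.
  by rewrite !comp_lfunE !(rtransE, harpE) mulrA.
- by rewrite linear0 comp_lfun0r comp_lfun0l.
by rewrite linearP /= !(comp_lfunDl, comp_lfunDr) -!(comp_lfunZl, comp_lfunZr)
           Hy Hz.
Qed.

Lemma stab_submod : submod (M := mod_tens dual_mod 'Hom(V, W)) (stab V W).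
Proof.
move=> h z; rewrite !mem_stab (_ : lact _ h z = tmap (rtrans h) \1 z); last first.
  by have := mod_tens_actE dual_mod 'Hom(V, W) h; rewrite /= => ->.
rewrite Lmap_shift => zS.
elim/tens_ind: (cop H h) => [a b||c x y Hx Hy].
- rewrite tliftE //; apply/homsP=> x; rewrite /wrapL -!comp_lfunA rtrans_harp.
  rewrite [in LHS]comp_lfunA [in LHS]comp_lfunA.
  rewrite -[(_ \o Lmap V W z \o harp_act V x)%VF]comp_lfunA.
  by rewrite (homsP _ _ _ zS) !comp_lfunA rtrans_harp.
- by rewrite linear0 mem0v.
by rewrite linearP memvD ?memvZ.
Qed.
End Stability.

Lemma tens_fun_act (U : vectType k) h (z : mod_tens dual_mod U) t :
  tens_fun (lact (mod_tens dual_mod U) h z) t = tens_fun z (t * h).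
Proof.
rewrite (_ : lact _ h z = tmap (rtrans h) \1 z); last first.
  by have := mod_tens_actE dual_mod U h; rewrite /= => ->.
elim/tens_ind: z => [f T||c x y Hx Hy].
- by rewrite tmapE !tens_funE rtransE id_lfunE.
- by rewrite linear0 /tens_fun !linear0 !zero_lfunE.
by rewrite linearP /= !tens_fun_linear !(add_lfunE, scale_lfunE) Hx Hy.
Qed.

Section Datum.
Variable A : grouplike_sub.
Implicit Types l m n : chr k A.

Definition Stab_mod (K : comodAlg) (V W : lrep K) : lrep H :=
  sub_mod (@stab_submod K V W).

Definition charsp m : {vspace dual H} :=
  (\bigcap_(a : A) lker (linfun (fun f : dual H =>
     ((f \o amull (gl a))%VF - m a *: f)%R)))%VS.

Lemma charspP m (f : dual H) :
  reflect (forall a h, f (gl a * h) = m a *: f h) (f \in charsp m).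
Proof.
have lin a : linear (fun g : dual H => ((g \o amull (gl a))%VF - m a *: g)%R).
  move=> c g h; rewrite comp_lfunDl -comp_lfunZl scalerDr opprD addrACA.
  by rewrite scalerBr !scalerA mulrC.
rewrite memvE; apply: (iffP subv_bigcapP) => [fC a h|fC a _].
  have := fC a isT; rewrite -memvE memv_ker linfunE // subr_eq0.
  by move/eqP/lfunP/(_ h); rewrite comp_lfunE lfunE scale_lfunE.
rewrite -memvE memv_ker linfunE // subr_eq0; apply/eqP/lfunP=> h.
by rewrite comp_lfunE lfunE scale_lfunE; apply: fC.
Qed.

Lemma charsp_submod m : submod (M := dual_mod) (charsp m).
Proof.
move=> h f /charspP fC; apply/charspP => a t.
by rewrite /= !rtransE -mulrA fC.
Qed.

Definition C_mod m : lrep H := sub_mod (@charsp_submod m).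

Record dyn_datum := DynDatum {
  dd_alg :> comodAlg;
  dd_simple : Hsimple dd_alg;
  dd_semisimple : semisimple_alg dd_alg;
  dd_coinv : forall x : dd_alg, coinvariant x <-> x \in 1%VS;
  dd_mod : chr k A -> lrep dd_alg;
  dd_irr : forall l, irreducible_mod (dd_mod l);
  dd_stab : forall l m,
    exists f : 'Hom(Stab_mod (dd_mod l) (dd_mod m), C_mod (l * m^-1)%g),
      mod_iso f }.

(* The objects of ^H M_S. *)
Record relHopfMod (S : comodAlg) := RelHopfMod {
  rh_sort :> vectType k;
  rh_coact : 'Hom(rh_sort, tens H rh_sort);
  rh_coactA : forall p,
    tassoc _ _ _ (tmap (cop H) \1 (rh_coact p)) = tmap \1 rh_coact (rh_coact p);
  rh_coact_cou : forall p, tevl _ (cou H) (rh_coact p) = p;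
  rh_act : 'Hom(S, 'End(rh_sort));
  rh_act1 : rh_act 1 = \1%VF;
  rh_actM : forall a b, rh_act (a * b) = (rh_act b \o rh_act a)%VF;
  rh_compat : forall p s,
    rh_coact (rh_act s p) = tact (rmul H) rh_act (coact S s) (rh_coact p) }.

Definition EndS (S : comodAlg) (P : relHopfMod S) : {vspace 'End(P)} :=
  homs (rh_act P) (rh_act P).

(* D = T_(-1) (x) T_(0) *)
Definition is_EndS_coact (S : comodAlg) (P : relHopfMod S) (T : 'End(P))
    (D : tens H 'End(P)) : Prop :=
  forall (f : dual H) (p : P),
    tevl _ f D p =
    tlift (fun h p0 => tlift (fun g q => (f (g * apdV h) : k) *: q)
                         (rh_coact P (T p0)))
      (rh_coact P p).

Definition comodAlg_iso_EndS (K S : comodAlg) (P : relHopfMod S)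
    (phi : 'Hom(K, 'End(P))) : Prop :=
  [/\ lker phi = 0%VS, limg phi = EndS P, phi 1 = \1%VF,
      forall x y, phi (x * y) = (phi x \o phi y)%VF
    & forall x, is_EndS_coact (phi x) (tmap \1 phi (coact K x))].

(* P (x)_S W is the quotient of P (x) W by the span of the p.s (x) w - p (x) s.w *)
Definition balanced (S : comodAlg) (P : relHopfMod S) (W : lrep S) :
    {vspace tens P W} :=
  limg (tlift (fun p => tlift (fun s w =>
    rh_act P s p \ox w - p \ox lact W s w) : tens S W -> tens P W)).

Definition tensS (S : comodAlg) (P : relHopfMod S) (W : lrep S) : vectType k :=
  quotv (balanced P W).
Definition pureS (S : comodAlg) (P : relHopfMod S) (W : lrep S) p w :
  tensS P W := qproj (balanced P W) (p \ox w).

Definition datum_equiv (D E : dyn_datum) : Prop :=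
  exists (P : relHopfMod E) (phi : 'Hom(D, 'End(P))),
    comodAlg_iso_EndS phi /\
    forall l, exists f : 'Hom(tensS P (dd_mod E l), dd_mod D l),
      [/\ lker f = 0%VS, limg f = fullv
        & forall x p w, f (pureS (phi x p) w) = lact (dd_mod D l) x (f (pureS p w))].

Definition idem m : H := #|A|%:R^-1 *: \sum_(a : A) m a^-1%g *: gl a.

Record dyn_twist := DynTwist {
  dt_fun :> chr k A -> tens H H;
  dt_unit : forall l, dt_fun l \is a GRing.unit;
  dt_weight : forall l (a : A),
    dt_fun l * (gl a \ox gl a) = (gl a \ox gl a) * dt_fun l;
  dt_cocycle : forall l,
    tassoc H H H
      (\sum_m tmap (cop H) \1 (dt_fun l) * (dt_fun (l * m^-1)%g \ox idem m))
    = tmap \1 (cop H) (dt_fun l) * (1 \ox dt_fun l);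
  dt_couL : forall l, tevl _ (cou H) (dt_fun l) = 1;
  dt_couR : forall l, tevr _ (cou H) (dt_fun l) = 1 }.

Definition gauge_equiv (J J' : dyn_twist) : Prop :=
  exists t : chr k A -> H,
    [/\ forall l, t l \is a GRing.unit,
        forall l, cou H (t l) = 1,
        forall l (a : A), t l * gl a = gl a * t l
      & forall l, J' l = cop H (t l)^-1 * J l
                         * \sum_m (t (l * m^-1)%g \ox (idem m * t l))].

Definition weight (X : lrep H) m (x : X) : Prop :=
  forall a : A, lact X (gl a) x = m a *: x.

Definition ftilde (X : lrep H) (f : dual X) (x : X) : dual H :=
  linfun (fun h : H => f (lact X (apd H h) x) : k^o).

Lemma ftildeE (X : lrep H) (f : dual X) (x : X) h :
  ftilde f x h = f (lact X (apd H h) x).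
Proof.
rewrite linfunE // => c a b.
by rewrite !linearP /= add_lfunE scale_lfunE linearP.
Qed.

(* (X (x) Y)^* : f (x) g evaluated on X (x) Y *)
Definition dual_tens (X Y : vectType k) (f : dual X) (g : dual Y) :
    dual (tens X Y) :=
  tlift (fun x y => (f x : k^o) * g y : k^o).

(* The identification Y^* (x) (X^* (x) V) = (X (x) Y)^* (x) V. *)
Definition dual_tens_assoc (X Y V : vectType k) :
    'Hom(tens (dual Y) (tens (dual X) V), tens (dual (tens X Y)) V) :=
  tlift (fun g => tlift (fun f v => dual_tens f g \ox v)).

Section Twist.
Variable D : dyn_datum.
Local Notation V := (dd_mod D).
Variable om : forall l m, 'Hom(Stab_mod (V l) (V m), C_mod (l * m^-1)%g).

(* om_(l,n)^-1 on C(l n^-1), as a function G : H -> Hom(V_l, V_n) *)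
Definition om_inv l n (f : dual H) : 'Hom(H, 'Hom(V l, V n)) :=
  tens_fun (vsval (((om l n)^-1)%VF (vsproj (charsp (l * n^-1)%g) f))).

(* Psi(l, x) for x of weight l^-1 n, so that V_n is the target module. *)
Definition Psi l n (X : lrep H) (x : X) : 'Hom(tens (dual X) (V l), V n) :=
  tlift (fun f v => om_inv l n (ftilde f x) 1 v).

Lemma PsiE l n (X : lrep H) (x : X) (f : dual X) v :
  Psi l n x (f \ox v) = om_inv l n (ftilde f x) 1 v.
Proof.
have fl : linear (fun g : dual X => ftilde g x).
  move=> c a b; apply/lfunP=> h.
  by rewrite add_lfunE scale_lfunE !ftildeE add_lfunE scale_lfunE.
rewrite tliftE //; split=> [w|g] c a b; last by rewrite linearP.
rewrite /om_inv fl !linearP /= tens_fun_linear.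
by rewrite !(add_lfunE, scale_lfunE).
Qed.

Definition omega_choice : Prop :=
  (forall l m, mod_iso (om l m)) /\
  (forall l (G : Stab_mod (V l) (V l)),
     Lmap (V l) (V l) (vsval G) = \1%VF -> vsval (om l l G) = ahval (cou H)).

Definition fusion (I : chr k A -> tens H H) : Prop :=
  forall l m n (X Y : lrep H) (x : X) (y : Y),
    weight m x -> weight n y ->
    let z : tens_mod X Y := tact (lact X) (lact Y) (I l) (x \ox y) in
    weight (m * n)%g z /\
    (Psi l (l * m * n)%g z \o dual_tens_assoc X Y (V l))%VF
      = (Psi (l * m)%g (l * m * n)%g y \o tmap \1 (Psi l (l * m)%g x))%VF.

End Twist.

Definition assoc_twist (D : dyn_datum) (J : dyn_twist) : Prop :=
  exists om, @omega_choice D om /\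
  exists I, [/\ fusion om I, forall l, I l \is a GRing.unit
              & forall l, J l = tmap apdV apdV (tswap _ _ (I l)^-1)].

End Datum.
End Hopf.

(* Main.v *)
Require Import Defs.
From mathcomp Require Import all_boot all_order all_algebra.
From mathcomp Require Import all_fingroup all_solvable all_field.
Import GRing.Theory VectorInternalTheory.
Local Open Scope ring_scope.

Set Implicit Arguments.
Unset Strict Implicit.
Unset Printing Implicit Defensive.

(** The functor F = P (x)_S - from S-modules to K-modules sends W_l to V_l and
commutes with tensoring by H-modules: F(X (x) W) = X (x) F(W). The maps
Psi_S(l, x), for x in X[m], are coordinates on Hom_S(X^* (x) W_l, W_{lm}), and
the maps Psi_K(l, x) are coordinates on Hom_K(X^* (x) V_l, V_{lm}). Comparing
them along F gives an automorphism of X[m] that is natural in X, so it is the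
action of an element S(u_l) of H. Both fusion operators I and I' describe
composition, and F preserves composition, whence
  Delta(S(u_l)) I'(l) = I(l) sum_m (S(u_l) P_m (x) S(u_{lm}))
([fusion_gauge]). Inverting this relation and applying (S^-1 (x) S^-1) o flip
gives the gauge relation for t(l) = u_l^-1 ([gauge_twist]).

The comparison is made at the level of stabilizers. An element of
Stab_K(V, W) is the same as a function G : H -> Hom(V, W) with
G(t) x = x_(0) G(S^-1(x_(-1)) t) for x in K ([stab_stab_fun],
[stab_fun_stab]), and F acts on these functions by
G'(h)(p (x) w) = p_(0) (x) G(S^-1(p_(-1)) h) w ([transports]). The function G'
exists and again satisfies the stabilizer condition because K = End_S(P) as
comodule algebras ([phi_coact], [transports_exists]), and G' = 0 only for G = 0
because W_n is irreducible ([transports_inj]). In the coordinates omega and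
for fixed l, this is an endomorphism of H^* = (+)_n C(l n^-1) that commutes
with right translations, that is, a left translation f |-> f(u_l .)
([translation_of_rel]). As it is injective, preserves each C(m) and fixes the
counit, u_l is a unit, commutes with A and has counit 1 ([gauge_element]). That
F is compatible with composition is [fusion_transport].

Two general facts are used throughout. The antipode of a finite-dimensional
Hopf algebra is bijective ([lker_apd]), proved by a Fitting decomposition and
the uniqueness of convolution inverses. The idempotents P_m add up to 1
([sum_idem]), where the field must be algebraically closed of characteristic
0. *)

(** * Multilinear calculus *)

Section Linearity.
Variables (k : fieldType).
Implicit Types (U V W X : vectType k) (B : falgType k).

Lemma linear_id V : linear (fun x : V => x).
Proof. by []. Qed.

Lemma linear_app V W (L : 'Hom(V, W)) X (f : X -> V) :
  linear f -> linear (fun x => L (f x)).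
Proof. by move=> lf c x y; rewrite lf linearP. Qed.

Lemma linear_eval V W (v : V) X (f : X -> 'Hom(V, W)) :
  linear f -> linear (fun x => f x v).
Proof. by move=> lf c x y; rewrite lf add_lfunE scale_lfunE. Qed.

Lemma linear_mull B (b : B) X (f : X -> B) :
  linear f -> linear (fun x => f x * b).
Proof. by move=> lf c x y; rewrite lf mulrDl -scalerAl. Qed.

Lemma linear_mulr B (b : B) X (f : X -> B) :
  linear f -> linear (fun x => b * f x).
Proof. by move=> lf c x y; rewrite lf mulrDr -scalerAr. Qed.

Lemma linear_compl V W U (g : 'Hom(V, W)) X (f : X -> 'Hom(W, U)) :
  linear f -> linear (fun x => f x \o g)%VF.
Proof. by move=> lf c x y; rewrite lf comp_lfunDl comp_lfunZl. Qed.

Lemma linear_compr V W U (g : 'Hom(W, U)) X (f : X -> 'Hom(V, W)) :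
  linear f -> linear (fun x => g \o f x)%VF.
Proof. by move=> lf c x y; rewrite lf comp_lfunDr comp_lfunZr. Qed.

Lemma linear_purel V W (w : W) X (f : X -> V) :
  linear f -> linear (fun x => f x \ox w).
Proof. by move=> lf c x y; rewrite lf pureDl. Qed.

Lemma linear_purer V W (v : V) X (f : X -> W) :
  linear f -> linear (fun x => v \ox f x).
Proof. by move=> lf c x y; rewrite lf pureDr. Qed.

Lemma linear_scalel V (v : V) X (f : X -> k^o) :
  linear f -> linear (fun x => (f x : k) *: v).
Proof. by move=> lf c x y; rewrite lf scalerDl scalerA. Qed.

Lemma linear_scaler V (a : k) X (f : X -> V) :
  linear f -> linear (fun x => a *: f x).
Proof. by move=> lf c x y; rewrite lf scalerDr !scalerA mulrC. Qed.

Lemma linear_add V X (f g : X -> V) :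
  linear f -> linear g -> linear (fun x => f x + g x).
Proof. by move=> lf lg c x y; rewrite lf lg scalerDr addrACA. Qed.

Lemma linear_opp V X (f : X -> V) :
  linear f -> linear (fun x => - f x).
Proof. by move=> lf c x y; rewrite lf opprD scalerN. Qed.

Lemma linear_tlift V W U X (f : X -> V -> W -> U) (z : tens V W) :
  (forall v w, linear (fun x => f x v w)) -> linear (fun x => tlift (f x) z).
Proof.
move=> lf c x y; rewrite !lfunE /= /tlift_fun.
rewrite scaler_sumr -big_split /=; apply: eq_bigr => i _.
rewrite scaler_sumr -big_split /=; apply: eq_bigr => j _.
by rewrite lf scalerDr !scalerA mulrC.
Qed.

Lemma linear_linfun V W X (f : X -> V -> W) :
  (forall x, linear (f x)) -> (forall v, linear (fun x => f x v)) ->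
  linear (fun x => linfun (f x)).
Proof.
move=> lv lx c x y; apply/lfunP => v.
by rewrite add_lfunE scale_lfunE !linfunE // lx.
Qed.

End Linearity.

Arguments linear_app {k V W L X f}.
Arguments linear_eval {k V W v X f}.
Arguments linear_mull {k B b X f}.
Arguments linear_mulr {k B b X f}.
Arguments linear_compl {k V W U g X f}.
Arguments linear_compr {k V W U g X f}.
Arguments linear_purel {k V W w X f}.
Arguments linear_purer {k V W v X f}.
Arguments linear_scalel {k V v X f}.
Arguments linear_scaler {k V a X f}.
Arguments linear_add {k V X f g}.
Arguments linear_opp {k V X f}.
Arguments linear_tlift {k V W U X f z}.
Arguments linear_linfun {k V W X f}.

(** Peels one operation off a linear expression. The branches must backtrack:
    a pattern variable such as ?L also matches a term that contains the bound
    variable, and the lemma then fails to apply. *)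
Ltac lin1 :=
  match goal with
  | |- linear (fun x => x) => exact: linear_id
  | |- linear (fun x => fun_of_lfun _ x) => apply: linear_app; exact: linear_id
  | |- linear (fun x => fun_of_lfun (tlift (@?f x)) ?z) =>
      first [ apply: (linear_tlift (f := f)) => ? ?
            | apply: (linear_eval (f := fun x => tlift (f x))) ]
  | |- linear (fun x => fun_of_lfun ?L (@?f x)) => apply: (linear_app (f := f))
  | |- linear (fun x => fun_of_lfun (@?f x) ?v) => apply: (linear_eval (f := f))
  | |- linear (fun x => comp_lfun (@?f x) ?v) => apply: (linear_compl (f := f))
  | |- linear (fun x => comp_lfun ?v (@?f x)) => apply: (linear_compr (f := f))
  | |- linear (fun x => pure (@?f x) ?v) => apply: (linear_purel (f := f))
  | |- linear (fun x => pure ?v (@?f x)) => apply: (linear_purer (f := f))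
  | |- linear (fun x => GRing.mul (@?f x) ?v) => apply: (linear_mull (f := f))
  | |- linear (fun x => GRing.mul ?v (@?f x)) => apply: (linear_mulr (f := f))
  | |- linear (fun x => GRing.scale (@?f x) ?v) => apply: (linear_scalel (f := f))
  | |- linear (fun x => GRing.scale ?v (@?f x)) => apply: (linear_scaler (f := f))
  | |- linear (fun x => linfun (@?f x)) => apply: (linear_linfun (f := f)) => ?
  | |- linear (fun x => GRing.add (@?f x) (@?g x)) =>
      apply: (linear_add (f := f) (g := g))
  | |- linear (fun x => GRing.opp (@?f x)) => apply: (linear_opp (f := f))
  | |- linear (fun_of_lfun _) => move=> ? ? ?; exact: linearP
  | |- linear _ => solve [by auto]
  | |- bilin _ => split=> ? /=
  end.
Ltac lin_steps := repeat (intros; lin1).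
Ltac lin := by lin_steps.

Section TensorCalculus.
Variables (k : fieldType).
Implicit Types (U V W X : vectType k) (B : falgType k).

Lemma linearZ_of V W (f : V -> W) c v : linear f -> f (c *: v) = c *: f v.
Proof. by move=> lf; rewrite -[LHS]linfunE // linearZ /= linfunE. Qed.

Lemma linear0_of V W (f : V -> W) : linear f -> f 0 = 0.
Proof. by move=> lf; rewrite -[0 in LHS](scale0r 0) linearZ_of // scale0r. Qed.

Lemma linear_sum_of V W (I : Type) (r : seq I) (F : I -> V) (f : V -> W) :
  linear f -> f (\sum_(i <- r) F i) = \sum_(i <- r) f (F i).
Proof.
move=> lf; have fD : {morph f : x y / x + y}.
  by move=> x y; have := lf 1 x y; rewrite !scale1r.
exact: (big_morph f fD (linear0_of lf)).
Qed.

(** [tlift f z] is a weighted sum of values of [f], whether or not [f] is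
    bilinear, so linear maps and extensionality pass through it freely. Only
    evaluation on pure tensors needs bilinearity. *)
Lemma app_tlift V W U X (L : 'Hom(U, X)) (f : V -> W -> U) z :
  L (tlift f z) = tlift (fun v w => L (f v w)) z.
Proof.
rewrite !lfunE /= /tlift_fun linear_sum; apply: eq_bigr => i _.
by rewrite linear_sum; apply: eq_bigr => j _; rewrite linearZ.
Qed.

Lemma tliftE0 V W U (f : V -> W -> U) z : tlift f z = tlift_fun f z.
Proof. by rewrite lfunE. Qed.

Lemma eq_tlift V W U (f g : V -> W -> U) z : f =2 g -> tlift f z = tlift g z.
Proof.
move=> fg; rewrite !tliftE0; apply: eq_bigr => i _; apply: eq_bigr => j _.
by rewrite fg.
Qed.

Lemma tlift_eq0 V W U (f : V -> W -> U) z :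
  (forall v w, f v w = 0) -> tlift f z = 0.
Proof.
move=> f0; rewrite tliftE0 /tlift_fun big1 // => i _.
by rewrite big1 // => j _; rewrite f0 scaler0.
Qed.

Lemma linear_tliftE V W U X (L : U -> X) (f : V -> W -> U) z :
  linear L -> L (tlift f z) = tlift (fun v w => L (f v w)) z.
Proof.
move=> lL; rewrite -linfunE // app_tlift.
by apply: eq_tlift => v w; rewrite linfunE.
Qed.

Lemma eval_tlift V W U X (f : V -> W -> 'Hom(U, X)) z u :
  tlift f z u = tlift (fun v w => f v w u) z.
Proof.
have lu : linear (fun g : 'Hom(U, X) => g u) by lin.
exact: (linear_tliftE f z lu).
Qed.

Lemma tlift_pure V W (z : tens V W) : tlift (@pure k V W) z = z.
Proof. by rewrite tliftE0 [RHS]tens_sum. Qed.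

Lemma tlift_lfun V W U (L : 'Hom(tens V W, U)) z :
  tlift (fun v w => L (v \ox w)) z = L z.
Proof. by rewrite -app_tlift tlift_pure. Qed.

Lemma eq_linear_tens V W U (f g : tens V W -> U) z :
  linear f -> linear g -> (forall v w, f (v \ox w) = g (v \ox w)) -> f z = g z.
Proof.
move=> lf lg fg; rewrite -(tlift_pure z) !linear_tliftE //.
exact: eq_tlift.
Qed.

(** Finite dimension of [V] enters here, through a basis. *)
Lemma tens_fun_surj V W (G : 'Hom(V, W)) : exists z, tens_fun z = G.
Proof.
have lc i : linear (fun v : V => v2r v 0 i : k^o).
  by move=> c x y; rewrite linearP !mxE.
exists (\sum_i linfun (fun v : V => v2r v 0 i : k^o) \ox G (vbase i)).
apply/lfunP => v; rewrite [in RHS](vbase_sum v) /tens_fun !linear_sum sum_lfunE.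
apply: eq_bigr => i _.
by have /= -> := tens_funE; rewrite linfunE // linearZ.
Qed.

Lemma tens_fun_eval V W v : linear (fun z : tens (dual V) W => tens_fun z v).
Proof. by move=> c x y; rewrite tens_fun_linear add_lfunE scale_lfunE. Qed.

Lemma tlift_tmap V V' W W' U (f : V' -> W' -> U) (g : 'Hom(V, V'))
    (h : 'Hom(W, W')) z :
  bilin f -> tlift f (tmap g h z) = tlift (fun v w => f (g v) (h w)) z.
Proof.
move=> bf; rewrite -[in LHS](tlift_pure z) (app_tlift (tmap g h)).
rewrite (app_tlift (tlift f)); apply: eq_tlift => v w.
by rewrite tmapE tliftE.
Qed.

Lemma tlift_tlift V W V' W' U (f : V -> W -> U) (g : V' -> W' -> tens V W) z :
  tlift f (tlift g z) = tlift (fun v w => tlift f (g v w)) z.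
Proof. exact: app_tlift. Qed.

Lemma tlift_mul B B' U (f : B -> B' -> U) (y z : tens B B') :
  bilin f ->
  tlift f (y * z) = tlift (fun a b => tlift (fun c d => f (a * c) (b * d)) z) y.
Proof.
move=> bf; have ly : linear (fun x => tlift f (x * z)) by lin.
rewrite -[in LHS](tlift_pure y) (linear_tliftE _ _ ly); apply: eq_tlift => a b.
have lz : linear (fun x => tlift f ((a \ox b) * x)) by lin.
rewrite -[in LHS](tlift_pure z) (linear_tliftE _ _ lz); apply: eq_tlift => c d.
by rewrite pureM tliftE.
Qed.

Lemma tlift_exch V W V' W' U (f : V -> W -> V' -> W' -> U) y z :
  tlift (fun v w => tlift (f v w) z) y
    = tlift (fun v' w' => tlift (fun v w => f v w v' w') y) z.
Proof.
have E V1 W1 (g : V1 -> W1 -> U) (x : tens V1 W1) :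
    tlift g x = \sum_p x p.1 p.2 *: g (vbase p.1) (vbase p.2).
  by rewrite tliftE0 /tlift_fun pair_bigA.
rewrite E [RHS]E.
under eq_bigr => p _ do rewrite E scaler_sumr.
rewrite exchange_big; apply: eq_bigr => q _ /=.
rewrite E scaler_sumr; apply: eq_bigr => p _.
by rewrite !scalerA mulrC.
Qed.

End TensorCalculus.
Arguments linear_sum_of {k V W I r F f}.

(** * Comodules in Sweedler form *)

Section Comodule.
Variables (k : closedFieldType) (H : hopfAlg k) (P : vectType k).
Variable d : 'Hom(P, tens H P).
Hypothesis dA : forall p,
  tassoc _ _ _ (tmap (cop H) \1 (d p)) = tmap \1 d (d p).

(** Both sides are the sum of [F] over p_(-2) (x) p_(-1) (x) p_(0). The
    coactions of comodule algebras and of Hopf modules, and the coproduct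
    itself, are all instances of [d]. *)
Lemma coassoc (U : vectType k) (F : H -> H -> P -> U) p :
  (forall b q, linear (fun a => F a b q)) ->
  (forall a q, linear (fun b => F a b q)) ->
  (forall a b, linear (fun q => F a b q)) ->
  tlift (fun h q => tlift (fun a b => F a b q) (cop H h)) (d p)
    = tlift (fun a q => tlift (fun b r => F a b r) (d q)) (d p).
Proof.
move=> F1 F2 F3.
transitivity (tlift (fun a w => tlift (fun b r => F a b r) w) (tmap \1 d (d p))).
  rewrite -dA -[in RHS](tlift_pure (d p)).
  rewrite (app_tlift (tmap _ _)).
  rewrite (app_tlift (tassoc _ _ _)) (app_tlift (tlift _)).
  apply: eq_tlift => h q; rewrite tmapE id_lfunE.
  rewrite -[in RHS](tlift_pure (cop H h)).
  have l : linear (fun x => tassoc H H P (x \ox q)) by lin.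
  rewrite (linear_tliftE _ _ l) (app_tlift (tlift _)).
  apply: eq_tlift => a b.
  by rewrite tassocE; do 2![rewrite tliftE; last by lin].
rewrite tlift_tmap; last by lin.
by apply: eq_tlift => a q; rewrite id_lfunE.
Qed.

Hypothesis dcou : forall p, tevl _ (cou H) (d p) = p.

Lemma counit (U : vectType k) (F : P -> U) p :
  linear F -> tlift (fun h q => (cou H h : k) *: F q) (d p) = F p.
Proof.
move=> lF; rewrite -[in RHS](dcou p) (linear_tliftE _ _ lF).
by apply: eq_tlift => h q; rewrite linearZ_of.
Qed.
End Comodule.

(** * The antipode *)

Section Antipode.
Variables (k : closedFieldType) (H : hopfAlg k).
Local Notation S := (apd H).

Lemma coprodA (U : vectType k) (F : H -> H -> H -> U) x :
  (forall b q, linear (fun a => F a b q)) ->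
  (forall a q, linear (fun b => F a b q)) ->
  (forall a b, linear (fun q => F a b q)) ->
  tlift (fun y c => tlift (fun a b => F a b c) (cop H y)) (cop H x)
    = tlift (fun a y => tlift (fun b c => F a b c) (cop H y)) (cop H x).
Proof. exact: (coassoc (@copA k H)). Qed.

Lemma counitL (U : vectType k) (F : H -> U) x :
  linear F -> tlift (fun a b => (cou H a : k) *: F b) (cop H x) = F x.
Proof. exact: (counit (@couL k H)). Qed.

Lemma counitR (U : vectType k) (F : H -> U) x :
  linear F -> tlift (fun a b => (cou H b : k) *: F a) (cop H x) = F x.
Proof.
move=> lF; rewrite -[in RHS](couR x) (linear_tliftE _ _ lF).
by apply: eq_tlift => a b; rewrite linearZ_of.
Qed.

Lemma apd_convL (U : vectType k) (F : H -> U) x :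
  linear F ->
  tlift (fun a b => F (S a * b)) (cop H x) = (cou H x : k) *: F 1.
Proof. by move=> lF; rewrite -(linear_tliftE _ _ lF) apdL linearZ_of. Qed.

Lemma apd_convR (U : vectType k) (F : H -> U) x :
  linear F ->
  tlift (fun a b => F (a * S b)) (cop H x) = (cou H x : k) *: F 1.
Proof. by move=> lF; rewrite -(linear_tliftE _ _ lF) apdR linearZ_of. Qed.

(** A left and a right convolution inverse agree. The product is a parameter
    because the odd powers of the antipode are multiplicative for the flipped
    product only. *)
Lemma conv_inv_uniq (B : vectType k) (mu : B -> B -> B) (e : B)
    (f g h : 'Hom(H, B)) :
  bilin mu -> associative mu -> left_id e mu -> right_id e mu ->
  (forall x, tlift (fun a b => mu (f a) (g b)) (cop H x) = (cou H x : k) *: e) ->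
  (forall x, tlift (fun a b => mu (g a) (h b)) (cop H x) = (cou H x : k) *: e) ->
  f = h.
Proof.
move=> [mul mur] muA mu1l mu1r fg gh; apply/lfunP => x.
have lm c (X : vectType k) (F : X -> B) : linear F -> linear (fun y => mu (F y) c).
  by move=> lF a y z; rewrite lF mul.
have lm' c (X : vectType k) (F : X -> B) : linear F -> linear (fun y => mu c (F y)).
  by move=> lF a y z; rewrite lF mur.
rewrite -[LHS](counitR (F := f)); last by lin.
transitivity (tlift (fun a y => tlift (fun b c => mu (mu (f a) (g b)) (h c))
    (cop H y)) (cop H x)).
  apply: eq_tlift => a y.
  transitivity (mu (f a) (tlift (fun b c => mu (g b) (h c)) (cop H y))).
    by rewrite gh linearZ_of // mu1r.
  rewrite (linear_tliftE (L := mu (f a))) //.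
  by apply: eq_tlift => b c; rewrite muA.
rewrite -coprodA.
- rewrite -[RHS](counitL (F := h)); last by lin.
  apply: eq_tlift => y c.
  rewrite -(linear_tliftE (L := fun z => mu z (h c))) // fg.
  by rewrite (linearZ_of (f := fun z => mu z _)) // mu1l.
- by move=> b c; apply: (lm _ H (fun a => mu (f a) (g b))); apply: (lm _ H f); lin.
- by move=> a c; apply: (lm _ H (fun b => mu (f a) (g b))); apply: (lm' _ H g); lin.
- by move=> a b; apply: (lm' _ H h); lin.
Qed.

Lemma apd1 : S 1 = 1.
Proof.
have := apdL (1 : H); rewrite !rmorph1 tens1E tliftE; last by lin.
by rewrite mulr1 scale1r.
Qed.

Lemma cou_apd x : cou H (S x) = cou H x.
Proof.
transitivity (tlift (fun a b => (cou H b : k) *: (cou H (S a) : k^o)) (cop H x)).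
  by rewrite counitR //; lin.
transitivity (cou H (tlift (fun a b => S a * b) (cop H x))).
  rewrite (app_tlift (cou H)); apply: eq_tlift => a b.
  by rewrite rmorphM /= mulrC.
by rewrite apdL linearZ /= rmorph1 -[RHS]mulr1.
Qed.

(** S(a_1 b) a_2 = S(a_1 b_1) a_2 b_2 S(b_3), and S(c_1) c_2 collapses for
    c = a b_1. *)
Lemma apd_mul_cancel a b :
  tlift (fun x y => S (x * b) * y) (cop H a) = (cou H a : k) *: S b.
Proof.
symmetry.
transitivity (tlift (fun b1 b2 => tlift (fun x y => tlift (fun c d =>
    S (x * c) * (y * (d * S b2))) (cop H b1)) (cop H a)) (cop H b)).
  rewrite -(counitL (F := fun b2 => (cou H a : k) *: S b2)); last by lin.
  apply: eq_tlift => b1 b2.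
  rewrite scalerA [_ * _]mulrC -[_ * _](rmorphM (cou H)).
  have l : linear (fun z => z * S b2) by lin.
  rewrite -[S b2 in LHS]mul1r scalerAl -apdL rmorphM /= tlift_mul; last by lin.
  rewrite (linear_tliftE _ _ l); apply: eq_tlift => x y.
  by rewrite (linear_tliftE _ _ l); apply: eq_tlift => c d; rewrite !mulrA.
rewrite tlift_exch; apply: eq_tlift => x y.
rewrite coprodA; try by lin.
rewrite -(counitR (F := fun c => S (x * c) * y)); last by lin.
apply: eq_tlift => c z.
by rewrite (apd_convR (F := fun w => S (x * c) * (y * w))) ?mulr1 //; lin.
Qed.

(** S(b) S(a) = S(a_1 b) a_2 S(a_3) = S(a b), by [apd_mul_cancel]. *)
Lemma apdM a b : S (a * b) = S b * S a.
Proof.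
transitivity (tlift (fun x y => (cou H x : k) *: (S b * S y)) (cop H a));
  last first.
  by rewrite (counitL (F := fun y => S b * S y)) //; lin.
transitivity (tlift (fun x y => tlift (fun c d => S (c * b) * (d * S y))
    (cop H x)) (cop H a)); last first.
  apply: eq_tlift => x y; rewrite scalerAl -apd_mul_cancel.
  rewrite (linear_tliftE (L := fun z => z * S y)); last by lin.
  by apply: eq_tlift => c d; rewrite mulrA.
rewrite coprodA; try by lin.
rewrite -(counitR (F := fun c => S (c * b))); last by lin.
apply: eq_tlift => c z.
by rewrite (apd_convR (F := fun w => S (c * b) * w)) ?mulr1 //; lin.
Qed.

(** Both sides are convolution inverses of the coproduct, in the linear maps
    from H to H (x) H. *)
Lemma cop_apd x : cop H (S x) = tlift (fun a b => S b \ox S a) (cop H x).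
Proof.
pose f : 'Hom(H, tens H H) := (cop H \o S)%VF.
pose h : 'Hom(H, tens H H) := (tlift (fun a b => S b \ox S a) \o cop H)%VF.
suff fh : f = h by have /lfunP/(_ x) := fh; rewrite !comp_lfunE.
apply: (conv_inv_uniq (mu := fun y z : tens H H => y * z) (e := 1) (g := cop H)).
- by lin.
- by move=> u v w; rewrite mulrA.
- by move=> u; rewrite mul1r.
- by move=> u; rewrite mulr1.
- move=> y; transitivity (cop H (tlift (fun a b => S a * b) (cop H y))).
    rewrite (app_tlift (cop H)); apply: eq_tlift => a b.
    by rewrite comp_lfunE rmorphM.
  by rewrite apdL linearZ /= rmorph1.
move=> y; rewrite -[1]/(1 \ox 1).
transitivity (tlift (fun y1 y2 => tlift (fun a b => tlift (fun c d =>
    (a * S d) \ox (b * S c)) (cop H y2)) (cop H y1)) (cop H y)).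
  apply: eq_tlift => y1 y2; rewrite comp_lfunE -[cop H y1 in LHS]tlift_pure.
  rewrite (linear_tliftE (L := fun z => z * _)); last by lin.
  apply: eq_tlift => a b.
  rewrite (linear_tliftE (L := fun z => _ * z)); last by lin.
  by apply: eq_tlift => c d; rewrite pureM.
rewrite coprodA; try by lin.
transitivity (tlift (fun a z => (a * S z) \ox (1 : H)) (cop H y)).
  apply: eq_tlift => a z.
  rewrite -coprodA; try by lin.
  rewrite -(counitL (F := fun z => (a * S z) \ox (1 : H))); last by lin.
  apply: eq_tlift => w d.
  by rewrite (apd_convR (F := fun v => (a * S d) \ox v)) //; lin.
by rewrite (apd_convR (F := fun v => v \ox (1 : H))) //; lin.
Qed.
End Antipode.

Section AntipodeBijective.
Variables (k : closedFieldType) (H : hopfAlg k).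
Local Notation S := (apd H).

Definition apd_iter n : 'End(H) := iter n (fun f => (S \o f)%VF) \1%VF.
Local Notation Sn := apd_iter.

Lemma apd_iterD m n : Sn (m + n) = (Sn m \o Sn n)%VF.
Proof.
by elim: m => [|m IH]; rewrite ?comp_lfun1l // addSn /= IH comp_lfunA.
Qed.

Lemma apd_iterSr n x : Sn n.+1 x = Sn n (S x).
Proof. by rewrite -addn1 apd_iterD comp_lfunE /= comp_lfun1r. Qed.

Lemma apd_iter1 n : Sn n 1 = 1.
Proof. by elim: n => [|n IH]; rewrite ?id_lfunE //= comp_lfunE IH apd1. Qed.

(** The product for which the n-th power of the antipode is multiplicative,
    when [b] is the parity of n. *)
Definition opp_mul (b : bool) (x y : H) := if b then y * x else x * y.

Lemma apd_iterM n x y : Sn n (x * y) = opp_mul (odd n) (Sn n x) (Sn n y).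
Proof.
elim: n => [|n IH] /=; rewrite ?id_lfunE // !comp_lfunE IH.
by rewrite /opp_mul; case: (odd n); rewrite apdM.
Qed.

Lemma cop_apd_iter2 n x :
  cop H (Sn n.*2 x) = tmap (Sn n.*2) (Sn n.*2) (cop H x).
Proof.
elim: n => [|n IH]; first by rewrite tmap_id !id_lfunE.
rewrite doubleS /= !comp_lfunE !cop_apd (tlift_tlift (fun a b => S b \ox S a)).
rewrite IH tlift_tmap; last by lin.
rewrite -[RHS]tlift_lfun; apply: eq_tlift => a b.
rewrite tliftE; last by lin.
by rewrite tmapE !comp_lfunE.
Qed.

Lemma cou_apd_iter n x : cou H (Sn n x) = cou H x.
Proof. by elim: n => [|n IH]; rewrite ?id_lfunE //= comp_lfunE cou_apd. Qed.

(** S^n and S^n pi have the same convolution inverse S^(n+1) = S^(n+1) pi,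
    because pi is a coalgebra map. *)
Lemma apd_iter_cancel (pi : 'End(H)) n :
  (forall x, cop H (pi x) = tmap pi pi (cop H x)) ->
  (forall x, cou H (pi x) = cou H x) ->
  (Sn n.+1 \o pi = Sn n.+1)%VF -> (Sn n \o pi = Sn n)%VF.
Proof.
move=> pi_cop pi_cou piS; symmetry.
apply: (conv_inv_uniq (mu := opp_mul (odd n)) (e := 1) (g := Sn n.+1)).
- by rewrite /opp_mul; case: (odd n); lin.
- by rewrite /opp_mul; case: (odd n) => x y z; rewrite mulrA.
- by rewrite /opp_mul; case: (odd n) => x; rewrite ?mul1r ?mulr1.
- by rewrite /opp_mul; case: (odd n) => x; rewrite ?mul1r ?mulr1.
- move=> x; transitivity (tlift (fun a b => Sn n (a * S b)) (cop H x)).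
    by apply: eq_tlift => a b; rewrite apd_iterSr apd_iterM.
  by rewrite (apd_convR (F := Sn n)) ?apd_iter1 //; lin.
move=> x; transitivity (tlift (fun a b => Sn n (S a * b)) (cop H (pi x))).
  rewrite pi_cop tlift_tmap; last by lin.
  apply: eq_tlift => a b.
  rewrite [RHS]apd_iterM -apd_iterSr -(comp_lfunE (Sn n.+1) pi) piS.
  by rewrite (comp_lfunE (Sn n) pi).
by rewrite (apd_convL (F := Sn n)) ?apd_iter1 ?pi_cou //; lin.
Qed.

Lemma apd_iter_inj (pi : 'End(H)) n :
  (forall x, cop H (pi x) = tmap pi pi (cop H x)) ->
  (forall x, cou H (pi x) = cou H x) ->
  (Sn n \o pi = Sn n)%VF -> pi = \1%VF.
Proof.
move=> pi_cop pi_cou; elim: n => [|n IH]; first by rewrite comp_lfun1l.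
by move=> /apd_iter_cancel -/(_ pi_cop pi_cou).
Qed.

(** The image dimension along the exponents 2, 4, 8, ... cannot drop for ever.
    Even exponents are used because S^2 is a coalgebra map and S is not. *)
Lemma apd_iter_stable :
  exists n, \dim (limg (Sn (n.+1).*2 \o Sn (n.+1).*2)%VF)
    = \dim (limg (Sn (n.+1).*2)).
Proof.
pose e n := \dim (limg (Sn n)).
have eS n m : (e (n + m) <= e m)%N.
  rewrite /e apd_iterD limg_comp.
  by rewrite -[leqRHS](limg_ker_dim (Sn n)) leq_addl.
have : (e (1).*2 <= e (1).*2)%N by [].
move: {2}(e _) => v; rewrite -[1%N]/(0.+1); move: 0%N => n.
elim: v n => [|v IH] n le_v.
  exists n; rewrite -apd_iterD -/(e _) -/(e _).
  by apply/eqP; rewrite eqn_leq eS; move: le_v; rewrite leqn0 => /eqP->.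
have [eq_e|ne_e] := eqVneq (e ((n.+1).*2 + (n.+1).*2)%N) (e (n.+1).*2).
  by exists n; rewrite -apd_iterD.
have : (e ((n.+1).*2 + (n.+1).*2)%N <= v)%N.
  by rewrite -ltnS (leq_trans _ le_v) // ltn_neqAle ne_e eS.
by rewrite -doubleD addSn; apply: IH.
Qed.

(** Fitting decomposition: for a large even N, T = S^N satisfies
    H = ker T (+) im T. The projection pi onto im T along ker T is a coalgebra
    map, since T is one, and T pi = T. Cancelling the N antipodes one at a time
    gives pi = 1, so that T, and with it S, is injective. *)
Lemma lker_apd : lker S = 0%VS.
Proof.
(* N is kept positive so that S^N kills the kernel of S. *)
have [n] := apd_iter_stable; set N := (n.+1).*2.
have T_cop x : cop H (Sn N x)
  = tmap (Sn N) (Sn N) (cop H x) by exact: cop_apd_iter2.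
have T_cou x : cou H (Sn N x) = cou H x by exact: cou_apd_iter.
have T_apd x : S x = 0 -> Sn N x = 0.
  by move=> Sx0; rewrite /N doubleS apd_iterSr Sx0 linear0.
have := @apd_iter_inj ^~ N;
  move: (Sn N) T_cop T_cou T_apd => T T_cop T_cou T_apd iterT dimT.
have capT : (limg T :&: lker T)%VS = 0%VS.
  apply/eqP; rewrite -dimv_eq0 -(eqn_add2r (\dim (T @: limg T))) limg_ker_dim.
  by rewrite -limg_comp dimT.
have T_inj x y : x \in limg T -> y \in limg T -> T x = T y -> x = y.
  move=> xT yT Txy; apply/eqP; rewrite -subr_eq0 -memv0 -capT memv_cap.
  by rewrite memvB // memv_ker linearB /= Txy subrr eqxx.
have imT : limg (T \o T)%VF = limg T.
  by apply/eqP; rewrite eqEdim dimT leqnn andbT limg_comp limgS ?subvf.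
pose g : 'End(H) := (T \o (T \o T)^-1)%VF; pose pi : 'End(H) := (g \o T)%VF.
have Tpi x : T (pi x) = T x.
  rewrite !comp_lfunE -[T (T _)]comp_lfunE limg_lfunVK //.
  by rewrite imT memv_img ?memvf.
have pi_im x : pi x \in limg T by rewrite !comp_lfunE memv_img ?memvf.
have piT x : pi (T x) = T x by apply: T_inj; rewrite ?Tpi // memv_img ?memvf.
have pi_cop_im x : cop H (pi x) = tmap pi pi (cop H (pi x)).
  have /memv_imgP[y _ ->] := pi_im x.
  rewrite T_cop -[RHS]comp_lfunE -tmap_comp.
  by congr (tmap _ _ _); apply/lfunP => z; rewrite comp_lfunE piT.
have pi_cop x : cop H (pi x) = tmap pi pi (cop H x).
  have tmap_pi z : tmap pi pi z = tmap g g (tmap T T z).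
    by rewrite /pi tmap_comp comp_lfunE.
  by rewrite pi_cop_im !tmap_pi -!T_cop Tpi.
have pi_cou x : cou H (pi x) = cou H x.
  by rewrite -T_cou Tpi T_cou.
have pi1 : pi = \1%VF.
  by apply: iterT => //; apply/lfunP => x; rewrite comp_lfunE Tpi.
apply/eqP; rewrite -subv0; apply/subvP => x; rewrite memv_ker memv0 => /eqP Sx0.
by rewrite -[x]id_lfunE -pi1 /pi comp_lfunE T_apd // linear0.
Qed.

Lemma apdK x : apdV H (S x) = x.
Proof. by rewrite lker0_lfunK ?lker_apd. Qed.
Lemma apdVK x : S (apdV H x) = x.
Proof. by rewrite lker0_lfunVK ?lker_apd. Qed.

Lemma apd_inj : injective S. Proof. exact: can_inj apdK. Qed.

Lemma apdV1 : apdV H 1 = 1.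
Proof. by rewrite -[1 in LHS]apd1 apdK. Qed.

Lemma apdVM x y : apdV H (x * y) = apdV H y * apdV H x.
Proof. by apply: apd_inj; rewrite apdM !apdVK. Qed.

Lemma cop_apdV x :
  cop H (apdV H x) = tlift (fun a b => apdV H b \ox apdV H a) (cop H x).
Proof.
rewrite -[x in RHS]apdVK cop_apd tlift_tlift -[LHS]tlift_pure.
apply: eq_tlift => a b; rewrite tliftE; last by lin.
by rewrite !apdK.
Qed.

Lemma apdV_convL (U : vectType k) (F : H -> U) x :
  linear F ->
  tlift (fun a b => F (apdV H b * a)) (cop H x) = (cou H x : k) *: F 1.
Proof.
move=> lF; have lG : linear (fun y => F (apdV H y)).
  by move=> c u v; rewrite linearP lF.
rewrite -[in RHS]apdV1 -(apd_convL _ lG); apply: eq_tlift => a b.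
by rewrite apdVM apdK.
Qed.
End AntipodeBijective.

(** * Character idempotents *)

(** The minimal polynomial divides 'X^N - 1, which is separable. *)
Lemma diagonalizable_finite_order (F : closedFieldType) n N (M : 'M[F]_n) :
  N%:R != 0 :> F -> (forall u : 'rV_n, iter N (mulmx^~ M) u
    = u) -> diagonalizable M.
Proof.
case: n M => [|n] M N0 MN.
  exists 1%:M; rewrite ?unitmx1 //; apply/is_diag_mxP => -[] //.
apply/diagonalizableP.
have [rs rsE] := closed_field_poly_normal ('X^N - 1 : {poly F}).
have lc : lead_coef ('X^N - 1 : {poly F}) = 1.
  apply/monicP; rewrite -[1]/(1%:P) monicXnsubC // lt0n.
  by apply: contraNneq N0 => ->.
rewrite lc scale1r in rsE.
exists rs; first by rewrite -separable_prod_XsubC -rsE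
  cyclotomic.separable_Xn_sub_1.
rewrite -rsE; apply: mxminpoly_min; rewrite rmorphB rmorph1 rmorphXn /= horner_mx_X.
apply/eqP; rewrite subr_eq0; apply/eqP/row_matrixP => i; rewrite !rowE mulmx1.
rewrite -[RHS]MN; move: (delta_mx _ _) => u; elim: N {N0 MN rsE lc} u => [|m IH] u.
  by rewrite expr0 mulmx1.
by rewrite iterSr -IH exprS mulmxA.
Qed.

Section Idempotents.
Variables (k : closedFieldType) (char0 : [pchar k] =i pred0).
Variables (H : hopfAlg k) (A : grouplike_sub H).
Implicit Types (m n : chr k A) (a b : A).

Lemma grp_mulC a b : (a * b = b * a)%g.
Proof. by apply: (centsP (gl_abelian A)); rewrite inE. Qed.

Lemma chr_mulC m n : (m * n = n * m)%g.
Proof. by apply/val_inj/ffunP => a; rewrite !chr_groupE mulrC. Qed.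

Lemma cardA_neq0 : #|A|%:R != 0 :> k.
Proof.
by rewrite ((pcharf0P k).1 char0) -lt0n; apply/card_gt0P; exists 1%g.
Qed.

Lemma chr_orth m n :
  #|A|%:R^-1 * (\sum_(a : A) m a^-1%g * n a) = (m == n)%:R.
Proof.
have [<-|mn] := eqVneq m n.
  under eq_bigr => a _ do rewrite chrV mulVf ?chr_neq0 //.
  by rewrite sumr_const mulVf ?cardA_neq0.
have [b mnb] : exists b, m b != n b.
  apply/existsP; apply: contraNT mn => /existsPn mn.
  by apply/eqP/val_inj/ffunP => a; apply/eqP; rewrite -[_ == _]negbK mn.
suff -> : \sum_(a : A) m a^-1%g * n a = 0 by rewrite mulr0.
set s := \sum_a _.
have sb : s = (m b)^-1 * n b * s.
  rewrite {1}/s (reindex_inj (mulgI b)) /= mulr_sumr; apply: eq_bigr => a _.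
  by rewrite !chrV !chrM invfM mulrACA.
apply/eqP; move/eqP: sb; rewrite -subr_eq0 -{1}[s]mul1r -mulrBl mulf_eq0.
case/orP=> //; rewrite subr_eq0 => /eqP e; case/eqP: mnb.
by rewrite -[LHS]mulr1 e mulrA mulfV ?chr_neq0 // mul1r.
Qed.

(** Orthogonality of characters, in the form that serves both for eigenvectors
    x of A (take f h = h x) and for functionals g in C(n) (take f h = g (h x)). *)
Lemma idem_eigen (V : vectType k) (f : 'Hom(H, V)) m n :
  (forall a, f (gl a) = n a *: f 1) -> f (idem m) = (m == n)%:R *: f 1.
Proof.
move=> fn; rewrite /idem linearZ linear_sum /=.
under eq_bigr => a _ do rewrite linearZ /= fn scalerA.
by rewrite -scaler_suml scalerA chr_orth.
Qed.

Arguments idem_eigen {V f m n}.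

Lemma gl_idem a m : gl a * idem m = m a *: idem m.
Proof.
rewrite /idem -scalerAr scalerA mulrC -scalerA; congr (_ *: _).
rewrite mulr_sumr scaler_sumr [RHS](reindex_inj (mulgI a)) /=.
apply: eq_bigr => b _.
by rewrite glM -scalerAr scalerA !chrV chrM invfM mulrA mulfV ?mul1r ?chr_neq0.
Qed.

Lemma idem_gl a m : idem m * gl a = gl a * idem m.
Proof.
rewrite /idem -scalerAl -scalerAr; congr (_ *: _).
rewrite mulr_suml mulr_sumr; apply: eq_bigr => b _.
by rewrite -scalerAl -scalerAr -!glM grp_mulC.
Qed.

Lemma idemM m n : idem m * idem n = (m == n)%:R *: idem n.
Proof.
have -> : idem m * idem n = rmul H (idem n) (idem m) by rewrite rmulE.
rewrite (idem_eigen (n := n)) ?rmulE ?mul1r // => a.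
by rewrite !rmulE ?mul1r gl_idem.
Qed.

Lemma apd_gl a : apd H (gl a) = gl a^-1%g.
Proof.
have := apdL (gl a); rewrite cop_gl cou_gl tliftE; last by lin.
rewrite scale1r => /(congr1 (fun x => x * gl a^-1%g)).
by rewrite -mulrA -glM mulgV gl1 mulr1 mul1r.
Qed.

Lemma apd_idem m : apd H (idem m) = idem m^-1%g.
Proof.
rewrite /idem linearZ linear_sum /=; congr (_ *: _).
rewrite (reindex_inj invg_inj) /=; apply: eq_bigr => a _.
by rewrite linearZ /= apd_gl invgK ffunE chrV invrK.
Qed.

Lemma idem_commute (x : H) m :
  (forall a, x * gl a = gl a * x) -> x * idem m = idem m * x.
Proof.
move=> xA; rewrite /idem -scalerAl -scalerAr; congr (_ *: _).
rewrite mulr_suml mulr_sumr; apply: eq_bigr => b _.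
by rewrite -scalerAl -scalerAr xA.
Qed.

Lemma gl_eigen_chr (x : H) (c : A -> k) :
  x != 0 -> (forall a, gl a * x = c a *: x) -> exists n : chr k A, n =1 c.
Proof.
move=> x0 xc.
have cI a y z : gl a * x = y *: x -> gl a * x = z *: x -> y = z.
  move=> -> /eqP; rewrite -subr_eq0 -scalerBl scaler_eq0 (negPf x0) orbF subr_eq0.
  by move/eqP.
have chr_c : is_chr [ffun a => c a].
  apply/andP; split.
    by rewrite ffunE; apply/eqP/(cI 1%g); rewrite ?xc // -xc gl1 mul1r scale1r.
  apply/forallP => a; apply/forallP => b; rewrite !ffunE;
    apply/eqP/(cI (a * b)%g) => //.
  by rewrite glM -mulrA xc -scalerAr xc scalerA mulrC.
by exists (Chr chr_c) => a; rewrite /= ffunE.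
Qed.

(** The left multiplications by A are commuting operators of finite order, so
    they have a common eigenbasis. On an eigenvector with character n, the
    idempotent of n acts by 1 and all others by 0. *)
Lemma sum_idem : \sum_(m : chr k A) idem m = 1.
Proof.
pose L a : 'M[k]_(dim H) :=
  lin1_mx (linfun (fun u : 'rV[k]_(dim H) => v2r (gl a * r2v u))).
have LE a u : u *m L a = v2r (gl a * r2v u).
  have l : linear (fun u => v2r (gl a * r2v u)).
    by move=> c x y; rewrite linearP mulrDr -scalerAr linearP.
  by rewrite mul_rV_lin1;
    apply: (linfunE (f := fun u : 'rV[k]_(dim H) => v2r (gl a * r2v u))).
have Lc : {in [seq L a | a : A] &, forall M N, comm_mx M N}.
  move=> M N /imageP[a _ ->] /imageP[b _ ->].
  apply/row_matrixP => i; rewrite !rowE !mulmxA !LE !v2rK !mulrA -!glM.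
  by rewrite grp_mulC.
have Ld : {in [seq L a | a : A], forall M, diagonalizable M}.
  move=> M /imageP[a _ ->]; apply: (diagonalizable_finite_order cardA_neq0) => u.
  have itE j : iter j (mulmx^~ (L a)) u = v2r (gl (a ^+ j)%g * r2v u).
    elim: j => [|j IH]; first by rewrite gl1 mul1r r2vK.
    by rewrite iterS IH LE v2rK mulrA -glM expgS.
  by rewrite itE -cardsT expg_cardG ?inE // gl1 mul1r r2vK.
have [P Pu /allP PD] := (codiagonalizableP _).1 (conj Lc Ld).
pose x i : H := r2v (row i P).
have x0 i : x i != 0.
  rewrite /x; apply/eqP => /(congr1 v2r); rewrite r2vK linear0 rowE.
  move/(congr1 (mulmx^~ (invmx P))); rewrite mulmxK // mul0mx => /matrixP/(_ 0 i).
  by rewrite !mxE !eqxx => /eqP; rewrite oner_eq0.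
have xE i a : gl a * x i = conjmx P (L a) i i *: x i.
  have : conjmx P (L a) *m P = P *m L a by rewrite conjumx // mulmxKV.
  have /PD/is_diag_mxP : L a \in [seq L a | a : A] by apply: image_f.
  move: (conjmx P (L a)) => C dC /(congr1 (row i)).
  rewrite !row_mul LE -/(x i) => /(congr1 r2v); rewrite v2rK => <-.
  rewrite /x -linearZ; congr r2v; apply/rowP => j; rewrite !mxE (bigD1 i) //= mxE.
  by rewrite big1 ?addr0 // => l li; rewrite mxE dC ?mul0r // eq_sym.
have sx i : (\sum_(m : chr k A) idem m) * x i = x i.
  have [n nE] := gl_eigen_chr (x0 i) (xE i).
  rewrite mulr_suml (bigD1 n) //= big1 ?addr0 => [|m mn].
    have -> : idem n * x i = rmul H (x i) (idem n) by rewrite rmulE.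
    rewrite (idem_eigen (n := n)) ?eqxx ?rmulE ?mul1r ?scale1r // => a.
    by rewrite !rmulE ?mul1r xE nE.
  have -> : idem m * x i = rmul H (x i) (idem m) by rewrite rmulE.
  rewrite (idem_eigen (n := n)) ?(negPf mn) ?scale0r // => a.
  by rewrite !rmulE ?mul1r xE nE.
rewrite -[LHS]mulr1 -[1 in LHS]v2rK -[1 in RHS]v2rK.
rewrite -[v2r 1](mulmxKV Pu) mulmx_sum_row linear_sum mulr_sumr.
by apply: eq_bigr => i _; rewrite linearZ -scalerAr sx.
Qed.
End Idempotents.
Arguments idem_eigen {k} char0 {H A V f m n}.

(** * Stabilizers as spaces of functions *)

Section StabilizerFunctions.
Variables (k : closedFieldType) (H : hopfAlg k) (K : comodAlg H) (V W : lrep K).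

Lemma Lmap_eval (z : tens (dual H) 'Hom(V, W)) (xi : dual H) (v : V) t :
  tens_fun (Lmap V W z (xi \ox v)) t
    = tlift (fun a b => (xi b : k) *: tens_fun z a v) (cop H t).
Proof.
have lT := @tens_fun_eval k H.
apply: (eq_linear_tens (f := fun z => tens_fun (Lmap V W z (xi \ox v)) t)
  (g := fun z => tlift (fun a b => (xi b : k) *: tens_fun z a v) (cop H t))).
- by move=> c x y; rewrite linearP /= add_lfunE scale_lfunE lT.
- apply: linear_tlift => a b; apply: linear_scaler.
  by apply: (linear_eval (f := fun z => tens_fun z a)); apply: lT.
move=> f T; rewrite LmapE tmapE tens_funE convlE /conv comp_lfunE.
rewrite (linear_tliftE (L := fun c : k^o => (c : k) *: T v)); last by lin.
by apply: eq_tlift => a b; rewrite tens_funE scale_lfunE scalerA mulrC.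
Qed.

Lemma harp_act_pure (U : lrep K) x (xi : dual H) (v : U) :
  harp_act U x (xi \ox v)
    = tlift (fun g y => harp H g xi \ox lact U y v) (coact K x).
Proof.
rewrite /harp_act comp_lfunE /tact eval_tlift.
by apply: eq_tlift => g y; rewrite tmapE.
Qed.

Lemma harp_act_eval x (F : tens (dual H) W) t :
  tens_fun (harp_act W x F) t
    = tlift (fun g y => lact W y (tens_fun F (apdV H g * t))) (coact K x).
Proof.
have lT := @tens_fun_eval k H.
apply: (eq_linear_tens (f := fun F => tens_fun (harp_act W x F) t)
  (g := fun F => tlift (fun g y =>
    lact W y (tens_fun F (apdV H g * t))) (coact K x))).
- by move=> c a b; rewrite linearP lT.
- apply: linear_tlift => g y; apply: linear_app; exact: lT.
move=> xi w; rewrite harp_act_pure.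
rewrite (linear_tliftE (L := fun z => tens_fun z t)); last exact: lT.
by apply: eq_tlift => g y; rewrite !tens_funE harpE linearZ.
Qed.

(** The functions G : H -> Hom(V, W) with G(t) x = x_(0) G(S^-1(x_(-1)) t). They
    correspond to the elements of Stab_K(V, W): see [stab_stab_fun] and
    [stab_fun_stab]. *)
Definition stab_fun (G : 'Hom(H, 'Hom(V, W))) : Prop :=
  forall t x v, G t (lact V x v)
    = tlift (fun g y => lact W y (G (apdV H g * t) v)) (coact K x).

Lemma apdV_cou h : cou H (apdV H h) = cou H h.
Proof. by rewrite -[RHS](congr1 (cou H) (apdVK h)) cou_apd. Qed.

(** K-linearity of L(z), evaluated at the counit in the H^* factor. *)
Lemma stab_stab_fun z : z \in stab V W -> stab_fun (tens_fun z).
Proof.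
rewrite mem_stab => /homsP zK t x v.
have lT := @tens_fun_eval k H.
have eps s (u : V) :
    tens_fun (Lmap V W z (ahval (cou H) \ox u)) s = tens_fun z s u.
  by rewrite Lmap_eval (counitR (F := fun a => tens_fun z a u)) //; lin.
have eps_harp g s (u : V) :
    tens_fun (Lmap V W z (harp H g (ahval (cou H)) \ox u)) s
      = (cou H g : k) *: tens_fun z s u.
  rewrite Lmap_eval -(counitR (F := fun a => (cou H g : k) *: tens_fun z a u));
    last by lin.
  by apply: eq_tlift => a b; rewrite harpE rmorphM /= apdV_cou scalerA mulrC.
have /lfunP/(_ (ahval (cou H) \ox v)) := zK x.
rewrite (comp_lfunE (Lmap V W z)) (comp_lfunE (harp_act W x)).
move/(congr1 (fun F => tens_fun F t)); rewrite harp_act_eval harp_act_pure.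
rewrite app_tlift (linear_tliftE (L := fun z => tens_fun z t)); last exact: lT.
rewrite (eq_tlift (g := fun g y => (cou H g : k) *: tens_fun z t (lact V y v))) //.
rewrite (counit (@coact_cou k H K)); last by lin.
move->; by apply: eq_tlift => g y; rewrite eps.
Qed.

(** Since S^-1 reverses the coproduct, K-linearity of L(z) at an arbitrary xi
    is the condition on functions, applied to the last factor of
    x_(-2) (x) x_(-1) (x) x_(0). *)
Lemma stab_fun_stab z : stab_fun (tens_fun z) -> z \in stab V W.
Proof.
move=> zK; rewrite mem_stab; apply/homsP => x; apply: tens_ext => xi v.
have lT := @tens_fun_eval k H.
rewrite (comp_lfunE (Lmap V W z)) (comp_lfunE (harp_act W x)).
apply: tens_fun_inj; apply/lfunP => t.
rewrite harp_act_eval harp_act_pure app_tlift.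
rewrite (linear_tliftE (L := fun z => tens_fun z t)); last exact: lT.
transitivity (tlift (fun g1 q => tlift (fun g2 y => tlift (fun a b =>
    (xi (apdV H g1 * b) : k) *: lact W y (tens_fun z (apdV H g2 * a) v))
    (cop H t)) (coact K q)) (coact K x)).
  apply: eq_tlift => g1 q; rewrite Lmap_eval tlift_exch; apply: eq_tlift => a b.
  rewrite harpE zK.
  apply: (linear_tliftE (L := fun w : W => (xi (apdV H g1 * b) : k) *: w)); lin.
rewrite -(coassoc (@coactA k H K)); try by lin.
apply: eq_tlift => g y; rewrite Lmap_eval app_tlift rmorphM /= tlift_mul;
  last by lin.
rewrite cop_apdV tlift_tlift; apply: eq_tlift => g1 g2.
rewrite tliftE; last by lin.
by apply: eq_tlift => a b; rewrite linearZ.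
Qed.
End StabilizerFunctions.

(** * The functions attached to a choice of isomorphisms *)

Section OmegaChoice.
Variables (k : closedFieldType) (H : hopfAlg k) (A : grouplike_sub H).
Variables (D : dyn_datum A).
Local Notation V := (dd_mod D).
Variable om : forall l m, 'Hom(Stab_mod (V l) (V m), C_mod (l * m^-1)%g).
Hypothesis omP : omega_choice om.

Lemma om_injective l n : injective (om l n).
Proof. by apply/lker0P; have [-> _ _] := omP.1 l n. Qed.

Lemma om_invK l n (u : C_mod (l * n^-1)%g) : om l n ((om l n)^-1%VF u) = u.
Proof. by apply: limg_lfunVK; have [_ -> _] := omP.1 l n; rewrite memvf. Qed.

Lemma om_inv_stab l n f : stab_fun (om_inv om l n f).
Proof. exact/stab_stab_fun/subvsP. Qed.

Lemma om_inv_linear l n : linear (om_inv om l n).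
Proof.
move=> c f g; rewrite /om_inv -tens_fun_linear; congr tens_fun.
by rewrite !linearP.
Qed.

(** This is the H-linearity of omega, read on functions on H. *)
Lemma om_inv_rtrans l n h f t : f \in charsp (l * n^-1)%g ->
  om_inv om l n (rtrans H h f) t = om_inv om l n f (t * h).
Proof.
move=> fC; rewrite /om_inv -tens_fun_act; congr (tens_fun _ t).
set u := vsproj _ f.
have uE : vsproj (charsp (l * n^-1)%g) (rtrans H h f)
  = lact (C_mod (l * n^-1)%g) h u.
  by rewrite [RHS]sub_actE /u vsprojK.
rewrite uE; have [_ _ omH] := omP.1 l n.
have -> : (om l n)^-1%VF (lact (C_mod (l * n^-1)%g) h u)
    = lact (Stab_mod (V l) (V n)) h ((om l n)^-1%VF u).
  by apply: om_injective; rewrite om_invK omH om_invK.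
by rewrite [lact (Stab_mod _ _) h _]sub_actE vsprojK //; apply/stab_submod/subvsP.
Qed.

Lemma om_inv_inj l n f : f \in charsp (l * n^-1)%g -> om_inv om l n f = 0 -> f = 0.
Proof.
move=> fC; rewrite /om_inv => f0.
have /val_inj z0 : vsval ((om l n)^-1%VF (vsproj (charsp (l * n^-1)%g) f))
    = vsval (0 : Stab_mod (V l) (V n)).
  by apply: tens_fun_inj; rewrite f0 linear0 /tens_fun linear0.
have : om l n ((om l n)^-1%VF (vsproj (charsp (l * n^-1)%g) f)) = 0.
  by rewrite z0 linear0.
by rewrite om_invK => /(congr1 vsval); rewrite vsprojK // linear0.
Qed.

Lemma om_inv_surj l n G : stab_fun G ->
  exists2 f, f \in charsp (l * n^-1)%g & om_inv om l n f = G.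
Proof.
have [z <-] := tens_fun_surj G => /stab_fun_stab zS.
exists (vsval (om l n (vsproj (stab (V l) (V n)) z))); first exact: subvsP.
rewrite /om_inv vsvalK; congr tens_fun.
have -> : (om l n)^-1%VF (om l n (vsproj (stab (V l) (V n)) z))
  = vsproj (stab (V l) (V n)) z.
  by apply: om_injective; rewrite om_invK.
by rewrite vsprojK.
Qed.

(** The counit corresponds to the identity of Stab_K(V_l, V_l), which is the
    tensor of the counit and the identity. *)
Lemma om_inv_cou l t : om_inv om l l (ahval (cou H)) t = (cou H t : k) *: \1%VF.
Proof.
pose z : tens (dual H) 'Hom(V l, V l) := (ahval (cou H) : dual H) \ox \1%VF.
have Lz : Lmap (V l) (V l) z = \1%VF.
  rewrite /z LmapE -tmap_id; congr tmap; apply/lfunP => f; apply/lfunP => s.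
  rewrite convlE /conv comp_lfunE id_lfunE -[RHS](counitL (F := f)); last by lin.
  exact: eq_tlift.
have zS : z \in stab (V l) (V l).
  by rewrite mem_stab Lz; apply/homsP => x; rewrite comp_lfun1l comp_lfun1r.
pose G : Stab_mod (V l) (V l) := vsproj (stab (V l) (V l)) z.
have omG : vsval (om l l G) = ahval (cou H) by apply: omP.2; rewrite /G vsprojK.
rewrite /om_inv -omG vsvalK.
have -> : (om l l)^-1%VF (om l l G) = G by apply: om_injective; rewrite om_invK.
by rewrite [in LHS]/G vsprojK // tens_funE omG.
Qed.
End OmegaChoice.

(** * Transport along an equivariant equivalence *)

Lemma tevl_ext (k : fieldType) (U V : vectType k) (y z : tens U V) :
  (forall f : dual U, tevl V f y = tevl V f z) -> y = z.
Proof.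
move=> yz; suff z0 (x : tens U V) : (forall f : dual U, tevl V f x = 0) -> x = 0.
  by apply/eqP; rewrite -subr_eq0; apply/eqP/z0 => f; rewrite linearB /= yz subrr.
move=> x0; apply/matrixP => i j.
have lc : linear (fun u : U => v2r u 0 i : k^o).
  by move=> c a b; rewrite linearP !mxE.
have := x0 (linfun (fun u : U => v2r u 0 i : k^o)).
have -> : tevl V (linfun (fun u : U => v2r u 0 i : k^o)) x
  = \sum_j x i j *: vbase j.
  rewrite /tevl tliftE0 /tlift_fun (bigD1 i) //= [X in _ + X]big1 ?addr0.
    apply: eq_bigr => l _; rewrite linfunE // /vbase r2vK mxE !eqxx scale1r //.
  move=> a ai; apply: big1 => b _; rewrite linfunE // /vbase r2vK mxE eqxx /=.
  by rewrite eq_sym (negPf ai) scale0r scaler0.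
move/(congr1 v2r); rewrite linear0 linear_sum => /rowP/(_ j).
rewrite summxE (bigD1 j) //= big1 => [|l lj]; last first.
  by rewrite linearZ /= /vbase r2vK !mxE eqxx eq_sym (negPf lj) mulr0.
by rewrite linearZ /= /vbase r2vK !mxE !eqxx mulr1 addr0.
Qed.

Section InducedModule.
Variables (k : closedFieldType) (H : hopfAlg k) (K S : comodAlg H).
Variables (P : relHopfMod S) (phi : 'Hom(K, 'End(P))).
Hypothesis phiP : comodAlg_iso_EndS phi.

(** The coaction of End_S(P) satisfies
    T_(-1) (x) T_(0)(p) = T(p_(0))_(-1) S^-1(p_(-1)) (x) T(p_(0))_(0).
    Multiplying by p_(-1) on the right cancels the antipode. *)
Lemma phi_coact x p :
  rh_coact P (phi x p)
    = tlift (fun g y => tlift (fun h q => (g * h) \ox phi y q) (rh_coact P p))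
        (coact K x).
Proof.
have [_ _ _ _ phi_co] := phiP.
have E r : tlift (fun g y => g \ox phi y r) (coact K x)
    = tlift (fun h q => tlift (fun g s => (g * apdV H h) \ox s)
        (rh_coact P (phi x q))) (rh_coact P r).
  apply: tevl_ext => f; rewrite !app_tlift.
  have := phi_co x f r; rewrite /tevl tlift_tmap; last by lin.
  rewrite eval_tlift.
  have tE g (s : P) : tlift (fun (u : H) (v : P) => (f u : k) *: v) (g \ox s)
    = (f g : k) *: s.
    by rewrite tliftE //; lin.
  move=> eqf; transitivity (tlift (fun g y =>
    ((f (\1%VF g) : k) *: phi y) r) (coact K x)).
    by apply: eq_tlift => g y; rewrite tE id_lfunE scale_lfunE.
  rewrite eqf; apply: eq_tlift => h q; rewrite app_tlift.
  by apply: eq_tlift => g s; rewrite tE.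
rewrite tlift_exch; symmetry.
(* S^-1(p_(-1)) p_(-2) is about to collapse. *)
transitivity (tlift (fun h q => tlift (fun h' q' => tlift (fun g s =>
   (g * (apdV H h' * h)) \ox s) (rh_coact P (phi x q'))) (rh_coact P q))
     (rh_coact P p)).
  apply: eq_tlift => h q.
  transitivity (tmap (rmul H h) \1 (tlift (fun g y => g \ox phi y q) (coact K x))).
    rewrite (app_tlift (tmap _ _)).
    by apply: eq_tlift => g y; rewrite tmapE rmulE id_lfunE.
  rewrite E (app_tlift (tmap _ _)); apply: eq_tlift => h' q'.
  rewrite (app_tlift (tmap _ _)); apply: eq_tlift => g s.
  by rewrite tmapE rmulE id_lfunE mulrA.
rewrite -(coassoc (@rh_coactA k H S P)); try by lin.
rewrite -[RHS](counit (@rh_coact_cou k H S P) (F :=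
  fun q => rh_coact P (phi x q))); last by lin.
apply: eq_tlift => w q.
rewrite (apdV_convL (F :=
  fun h => tlift (fun g s => (g * h) \ox s) (rh_coact P (phi x q)))); last by lin.
congr (_ *: _); rewrite -[RHS]tlift_pure; apply: eq_tlift => g s.
by rewrite mulr1.
Qed.

Section OneModule.
Variables (W : lrep S) (V : lrep K) (f : 'Hom(tensS P W, V)).
Hypothesis fP : [/\ lker f = 0%VS, limg f = fullv
  & forall x p w, f (pureS (phi x p) w) = lact V x (f (pureS p w))].

(** The map P (x) W -> P (x)_S W = V. Working with it avoids sections of the
    quotient. *)
Definition induced : 'Hom(tens P W, V) := (f \o qproj (balanced P W))%VF.

Lemma inducedE p w : induced (p \ox w) = f (pureS p w).
Proof. by rewrite comp_lfunE. Qed.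

Lemma induced_act x p w : induced (phi x p \ox w) = lact V x (induced (p \ox w)).
Proof. by have [_ _ f_act] := fP; rewrite !inducedE f_act. Qed.

Lemma induced_ker z : induced z = 0 -> z \in balanced P W.
Proof.
have /lker0P inj_f : lker f == 0%VS by apply/eqP; case: fP.
rewrite comp_lfunE -[0 in RHS](linear0 f) => /inj_f z0.
by rewrite -(lker_qproj (balanced P W)) memv_ker z0.
Qed.

Lemma induced_bal s p w : induced (rh_act P s p \ox w) = induced (p \ox lact W s w).
Proof.
apply/eqP; rewrite -subr_eq0 -linearB /= comp_lfunE.
suff /eqP-> : qproj (balanced P W) (rh_act P s p \ox w - p \ox lact W s w) == 0.
  by rewrite linear0.
rewrite -memv_ker lker_qproj; apply/memv_imgP; exists (p \ox (s \ox w));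
  first exact: memvf.
by rewrite tliftE; [rewrite tliftE //; lin | lin].
Qed.

Lemma induced_surj v : exists z, v = induced z.
Proof.
have /memv_imgP[z _ ->] : v \in limg induced.
  by have [_ f_surj _] := fP; rewrite limg_comp limg_qproj f_surj memvf.
by exists z.
Qed.

Lemma induced_ext (U : vectType k) (g h : 'Hom(V, U)) :
  (forall p w, g (induced (p \ox w)) = h (induced (p \ox w))) -> g = h.
Proof.
move=> gh; apply/lfunP => v; have [z ->] := induced_surj v.
by rewrite -!(comp_lfunE _ induced); congr (fun_of_lfun _ z);
  apply: tens_ext => p w; rewrite (comp_lfunE g) (comp_lfunE h).
Qed.
End OneModule.
End InducedModule.

Section Transport.
Variables (k : closedFieldType) (H : hopfAlg k) (K S : comodAlg H).
Variables (P : relHopfMod S) (phi : 'Hom(K, 'End(P))).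
Hypothesis phiP : comodAlg_iso_EndS phi.
Variables (W1 W2 : lrep S) (V1 V2 : lrep K).
Variables (f1 : 'Hom(tensS P W1, V1)) (f2 : 'Hom(tensS P W2, V2)).
Hypothesis f1P : [/\ lker f1 = 0%VS, limg f1 = fullv
  & forall x p w, f1 (pureS (phi x p) w) = lact V1 x (f1 (pureS p w))].
Hypothesis f2P : [/\ lker f2 = 0%VS, limg f2 = fullv
  & forall x p w, f2 (pureS (phi x p) w) = lact V2 x (f2 (pureS p w))].
Local Notation b1 := (induced f1).
Local Notation b2 := (induced f2).

(** G' is the image of G under P (x)_S -, where G is read as a map
    H (x) W1 -> W2 and H (x) (P (x)_S W1) is identified with
    P (x)_S (H (x) W1) by h (x) p (x) w |-> p_(0) (x) S^-1(p_(-1)) h (x) w. *)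
Definition transports (G : 'Hom(H, 'Hom(W1, W2))) (G' : 'Hom(H, 'Hom(V1, V2))) :
  Prop :=
  forall h p w, G' h (b1 (p \ox w))
    = tlift (fun g q => b2 (q \ox G (apdV H g * h) w)) (rh_coact P p).

Lemma transports_uniq G G1 G2 : transports G G1 -> transports G G2 -> G1 = G2.
Proof.
move=> GG1 GG2; apply/lfunP => h; apply: (induced_ext f1P) => p w.
by rewrite GG1 GG2.
Qed.

Lemma transports_linear c G1 G1' G2 G2' :
  transports G1 G1' -> transports G2 G2' ->
  transports (c *: G1 + G2) (c *: G1' + G2').
Proof.
move=> G1P G2P h p w; rewrite !(add_lfunE, scale_lfunE) G1P G2P.
pose L (G : 'Hom(H, 'Hom(W1, W2))) :=
  tlift (fun g q => b2 (q \ox G (apdV H g * h) w)) (rh_coact P p).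
have lL : linear L.
  apply: linear_tlift => g q; apply: linear_app; apply: linear_purer.
  by move=> a x y; rewrite !(add_lfunE, scale_lfunE).
by rewrite -/(L G1) -/(L G2) -lL.
Qed.

Lemma transports0 : transports 0 0.
Proof.
move=> h p w; rewrite !zero_lfunE tlift_eq0 // => g q.
by rewrite !zero_lfunE pure0r linear0.
Qed.

(** The formula for G' factors through P (x)_S W1 because G intertwines S, and
    G' intertwines K because of the form of the K-coaction on P. *)
Lemma transports_exists (G : 'Hom(H, 'Hom(W1, W2))) : stab_fun G ->
  exists2 G', stab_fun G' & transports G G'.
Proof.
move=> GS.
pose m h p w : V2 := tlift (fun g q =>
  b2 (q \ox G (apdV H g * h) w)) (rh_coact P p).
pose M h : 'Hom(tens P W1, V2) := tlift (m h).
have ME h p w : M h (p \ox w) = m h p w by rewrite tliftE //; rewrite /m; lin.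
have m_bal h s p w : m h (rh_act P s p) w = m h p (lact W1 s w).
  rewrite /m rh_compat /tact eval_tlift (app_tlift (tlift _)).
  transitivity (tlift (fun a s0 => tlift (fun g q =>
      b2 (q \ox lact W2 s0 (G (apdV H a * (apdV H g * h)) w))) (rh_coact P p))
        (coact S s)).
    apply: eq_tlift => a s0; rewrite tlift_tmap; last by lin.
    apply: eq_tlift => g q; rewrite (induced_bal f2) rmulE.
    by rewrite apdVM mulrA.
  rewrite tlift_exch; apply: eq_tlift => g q; rewrite GS.
  rewrite (linear_tliftE (L := fun w => b2 (q \ox w))) //; lin.
have M_ker h z : z \in balanced P W1 -> M h z = 0.
  move=> /memv_imgP[y _ ->]; rewrite (app_tlift (M h)) tlift_eq0 // => p sw.
  rewrite (app_tlift (M h)) tlift_eq0 // => s w.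
  by rewrite linearB /= !ME m_bal subrr.
(* b1^-1 is only a one-sided inverse; M_ker makes the choice irrelevant. *)
pose G1 h : 'Hom(V1, V2) := (M h \o b1^-1)%VF.
have m_linear p w : linear (fun h => m h p w) by rewrite /m; lin.
have M_linear : linear M.
  move=> c x y; apply: tens_ext => p w.
  by rewrite add_lfunE scale_lfunE !ME m_linear.
have G1_linear : linear G1 by apply: linear_compl.
have G1E h p w : linfun G1 h (b1 (p \ox w)) = m h p w.
  rewrite linfunE // comp_lfunE -ME; apply/eqP; rewrite -subr_eq0 -linearB /=.
  apply/eqP/M_ker/(induced_ker f1P); rewrite linearB /= limg_lfunVK ?subrr //.
  exact/memv_img/memvf.
exists (linfun G1); last by move=> h p w; rewrite G1E.
move=> t x v; have [z ->] := induced_surj f1P v.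
apply: (eq_linear_tens (f := fun z => linfun G1 t (lact V1 x (b1 z)))
 (g := fun z => tlift (fun g y =>
   lact V2 y (linfun G1 (apdV H g * t) (b1 z))) (coact K x))); try by lin.
move=> p w; rewrite -(induced_act f1P) G1E /m (phi_coact phiP) (app_tlift (tlift
  _)).
apply: eq_tlift => g y; rewrite (app_tlift (tlift _)) G1E /m app_tlift.
apply: eq_tlift => h q; rewrite tliftE; last by lin.
by rewrite (induced_act f2P) apdVM mulrA.
Qed.

(** The vectors w of W2 with P (x)_S w = 0 form a submodule. It is not W2, as
    P (x)_S W2 is nonzero, hence it is 0, and it contains all values of G. *)
Lemma transports_inj G :
  irreducible_mod W2 -> irreducible_mod V2 -> transports G 0 -> G = 0.
Proof.
move=> irrW irrV G0.
have bG0 p t w : b2 (p \ox G t w) = 0.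
  rewrite -[LHS](counit (@rh_coact_cou k H S P) (F :=
    fun p => b2 (p \ox G t w))); last by lin.
  transitivity (tlift (fun a y => tlift (fun b q =>
     b2 (q \ox G (apdV H b * (a * t)) w)) (rh_coact P y)) (rh_coact P p));
       last first.
    by apply: tlift_eq0 => a y; rewrite -G0 !zero_lfunE.
  rewrite -(coassoc (@rh_coactA k H S P)); try by lin.
  apply: eq_tlift => h q.
  rewrite -[t in LHS]mul1r -(apdV_convL (F := fun a => b2 (q \ox G (a * t) w)));
    last by lin.
  by apply: eq_tlift => a b; rewrite mulrA.
pose ann : {vspace W2} := lker (linfun (fun w => linfun (fun p => b2 (p \ox w)))).
have annP w : reflect (forall p, b2 (p \ox w) = 0) (w \in ann).
  rewrite memv_ker linfunE; last by lin.
  apply: (iffP eqP) => [w0 p|w0]; last by apply/lfunP => p;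
    rewrite linfunE ?w0 ?zero_lfunE //; lin.
  by rewrite -[b2 _](linfunE (f := fun p => b2 (p \ox w))) ?w0 ?zero_lfunE //; lin.
have [_ _ /(_ ann)] := irrW.
case=> [s w /annP w0||ann0|annT].
- by apply/annP => p; rewrite -(induced_bal f2) w0.
- exact: subvf.
- apply/lfunP => t; apply/lfunP => w; rewrite !zero_lfunE; apply/eqP.
  by rewrite -memv0 -ann0; apply/annP.
have [_ /(_ _)] := irrV; case; apply/eqP; rewrite -subv0; apply/subvP => v _.
have [z ->] := induced_surj f2P v; rewrite memv0; apply/eqP.
rewrite -(tlift_pure z) app_tlift tlift_eq0 // => p w.
by apply/annP; rewrite annT memvf.
Qed.

Lemma transports_shift G G' u : transports G G' ->
  transports (G \o rmul H u)%VF (G' \o rmul H u)%VF.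
Proof.
move=> GG h p w; rewrite (comp_lfunE G') GG; apply: eq_tlift => g q.
by rewrite (comp_lfunE G) !rmulE mulrA.
Qed.
End Transport.

(** * The gauge elements *)

Section Translation.
Variables (k : closedFieldType) (H : hopfAlg k) (R : dual H -> dual H -> Prop).
Hypothesis R_linear : forall c f1 f1' f2 f2',
  R f1 f1' -> R f2 f2' -> R (c *: f1 + f2) (c *: f1' + f2').
Hypothesis R_total : forall f, exists f', R f f'.
Hypothesis R_uniq : forall f', R 0 f' -> f' = 0.
Hypothesis R_rtrans : forall h f f', R f f' -> R (rtrans H h f) (rtrans H h f').

Lemma rel_functional f f1 f2 : R f f1 -> R f f2 -> f1 = f2.
Proof.
move=> R1 R2; apply/eqP; rewrite -subr_eq0; apply/eqP/R_uniq.
by have := R_linear (-1) R2 R1; rewrite !scaleN1r addNr addrC.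
Qed.

(** An endomorphism of H^* that commutes with right translations is a left
    translation: it is determined by f |-> (T f)(1), and this functional on H^*
    is evaluation at some u. The endomorphism is given by its graph, which
    spares building it as a linear map. *)
Lemma translation_of_rel : exists u, forall f, R f (f \o lmul H u)%VF.
Proof.
have R00 : R 0 0 by have [f0 R0] := R_total 0; move: (R_uniq R0) => f00;
  rewrite f00 in R0.
pose co i : dual H := linfun (fun x : H => v2r x 0 i : k^o).
have coE i x : co i x = v2r x 0 i.
  by rewrite linfunE // => c y z; rewrite linearP !mxE.
have fE (f : dual H) : f = \sum_i (f (vbase i) : k) *: co i.
  apply/lfunP=> x; rewrite sum_lfunE {1}(vbase_sum x) linear_sum.
  by apply: eq_bigr => i _; rewrite linearZ scale_lfunE coE /= [RHS]mulrC.
have [c' Rc] := fin_all_exists (fun i => R_total (co i)).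
pose T (f : dual H) : dual H := \sum_i (f (vbase i) : k) *: c' i.
have RT f : R f (T f).
  rewrite {1}(fE f) /T; apply: (big_ind2 R); last first.
  - move=> i _; rewrite -[_ *: co i]addr0 -[_ *: c' i]addr0.
    exact: R_linear.
  - by move=> f1 f1' f2 f2' R1 R2; have := R_linear 1 R1 R2; rewrite !scale1r.
  exact: R00.
exists (\sum_i (c' i 1 : k) *: vbase i) => f.
suff -> : (f \o lmul H (\sum_i (c' i 1 : k) *: vbase i))%VF = T f by [].
apply/lfunP => h; rewrite comp_lfunE lmulE.
have -> : T f h = T (rtrans H h f) 1.
  rewrite (rel_functional (RT (rtrans H h f)) (R_rtrans h (RT f))).
  by rewrite rtransE mul1r.
rewrite /T sum_lfunE mulr_suml linear_sum; apply: eq_bigr => i _.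
by rewrite -scalerAl linearZ scale_lfunE rtransE /= [LHS]mulrC.
Qed.

(** If u H were a proper subspace, then some nonzero functional would vanish on
    it, against injectivity. In finite dimension a right inverse suffices. *)
Lemma translation_unit u : (forall f, R f 0 -> f = 0) ->
  (forall f, R f (f \o lmul H u)%VF) -> u \is a GRing.unit.
Proof.
move=> R_inj Ru.
have im_u : limg (lmul H u) = fullv.
  set W := limg _; rewrite -(lker_qproj W).
  suff -> : qproj W = 0 by apply/vspaceP => x;
    rewrite memv_ker zero_lfunE eqxx memvf.
  apply/lfunP => x; rewrite zero_lfunE -[LHS]v2rK -[RHS](linear0 r2v); congr r2v.
  apply/rowP => i; rewrite [RHS]mxE.
  have lc : linear (fun y : quotv W => v2r y 0 i : k^o).
    by move=> c y z; rewrite linearP !mxE.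
  pose f : dual H := (linfun (fun y : quotv W => v2r y 0 i : k^o) \o qproj W)%VF.
  have f0 : f = 0.
    apply: R_inj; have := Ru f; congr (R f _); apply/lfunP => y.
    rewrite zero_lfunE /f -comp_lfunA comp_lfunE.
    suff -> : (qproj W \o lmul H u)%VF y = 0 by rewrite linear0.
    by apply/eqP; rewrite comp_lfunE -memv_ker lker_qproj memv_img ?memvf.
  have : f x = 0 by rewrite f0 zero_lfunE.
  by rewrite /f comp_lfunE linfunE.
have /memv_imgP[v _] : 1 \in limg (lmul H u) by rewrite im_u memvf.
rewrite lmulE => uv1.
have inj_u : injective (lmul H u).
  apply/lker0P; rewrite -dimv_eq0 -[lker _]capfv -(eqn_add2r (\dim (limg (lmul H
    u)))).
  by rewrite limg_ker_dim im_u.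
apply/unitrP; exists v; split=> //; apply: inj_u.
by rewrite !lmulE mulrA -uv1 mul1r mulr1.
Qed.
End Translation.

Section Characters.
Variables (k : closedFieldType) (char0 : [pchar k] =i pred0).
Variables (H : hopfAlg k) (A : grouplike_sub H).
Implicit Types (m n l : chr k A) (g : dual H).

Definition chr_part m g : dual H := (g \o lmul H (idem m))%VF.

Lemma chr_partE m g h : chr_part m g h = g (idem m * h).
Proof. by rewrite comp_lfunE lmulE. Qed.

Lemma chr_part_linear m : linear (chr_part m).
Proof. by move=> c f g; rewrite /chr_part comp_lfunDl comp_lfunZl. Qed.

Lemma chr_part_charsp m g : chr_part m g \in charsp m.
Proof.
apply/charspP => a h.
by rewrite !chr_partE mulrA idem_gl gl_idem -scalerAl linearZ.
Qed.

Lemma chr_part_id m n g : g \in charsp m -> chr_part n g = (n == m)%:R *: g.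
Proof.
move=> /charspP gC; apply/lfunP => h; rewrite chr_partE scale_lfunE.
have gE x : g (x * h) = (g \o rmul H h)%VF x by rewrite comp_lfunE rmulE.
rewrite gE (idem_eigen char0 (n := m)) => [|a]; first by rewrite -gE mul1r.
by rewrite -!gE gC mul1r.
Qed.

Lemma chr_part_sum g : \sum_m chr_part m g = g.
Proof.
apply/lfunP => h; rewrite sum_lfunE; under eq_bigr => m _ do rewrite chr_partE.
by rewrite -linear_sum -mulr_suml sum_idem // mul1r.
Qed.

Lemma chr_part_rtrans m h g : chr_part m (rtrans H h g) = rtrans H h (chr_part m g).
Proof. by apply/lfunP => t; rewrite chr_partE !rtransE chr_partE mulrA. Qed.

Lemma chr_part_gl m a g : chr_part m (g \o lmul H (gl a))%VF = m a *: chr_part m g.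
Proof.
apply/lfunP => h; rewrite scale_lfunE !chr_partE comp_lfunE lmulE mulrA gl_idem.
by rewrite -scalerAl linearZ.
Qed.

Lemma cou_charsp : ahval (cou H) \in charsp (1%g : chr k A).
Proof. by apply/charspP => a h; rewrite rmorphM /= cou_gl mul1r ffunE scale1r. Qed.

End Characters.

Section GaugeElement.
Variables (k : closedFieldType) (char0 : [pchar k] =i pred0).
Variables (H : hopfAlg k) (A : grouplike_sub H) (D E : dyn_datum A).
Variables (P : relHopfMod E) (phi : 'Hom(D, 'End(P))).
Hypothesis phiP : comodAlg_iso_EndS phi.
Variable f : forall l, 'Hom(tensS P (dd_mod E l), dd_mod D l).
Hypothesis fP : forall l, [/\ lker (f l) = 0%VS, limg (f l) = fullv
  & forall x p w, f l (pureS (phi x p) w) = lact (dd_mod D l) x (f l (pureS p w))].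
Variable om : forall l m,
  'Hom(Stab_mod (dd_mod D l) (dd_mod D m), C_mod (l * m^-1)%g).
Variable om' : forall l m,
  'Hom(Stab_mod (dd_mod E l) (dd_mod E m), C_mod (l * m^-1)%g).
Hypotheses (omP : omega_choice om) (omP' : omega_choice om').
Implicit Types (l m n : chr k A) (g : dual H).

(** The graph of the comparison between the coordinates given by the two
    choices of isomorphisms, on H^* = (+)_n C(l n^-1). *)
Definition twist_rel l g g' : Prop := forall n,
  transports (f l) (f n) (om_inv om' l n (chr_part (l * n^-1)%g g))
                         (om_inv om l n (chr_part (l * n^-1)%g g')).

Lemma twist_rel_linear l c g1 g1' g2 g2' :
  twist_rel l g1 g1' -> twist_rel l g2 g2' ->
  twist_rel l (c *: g1 + g2) (c *: g1' + g2').
Proof.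
move=> R1 R2 n; rewrite !chr_part_linear !om_inv_linear.
exact: transports_linear.
Qed.

Lemma chr_mulKV l m : (l * (m^-1 * l)^-1 = m)%g.
Proof. by rewrite invMg invgK mulgA mulgV mul1g. Qed.

Lemma chr_part_eq0 l g : (forall n, chr_part (l * n^-1)%g g = 0) -> g = 0.
Proof.
move=> g0; rewrite -(chr_part_sum char0 A g) big1 // => m _.
by rewrite -[m](chr_mulKV l) g0.
Qed.

Lemma twist_rel_total l g : exists g', twist_rel l g g'.
Proof.
have gn n : exists g', g' \in charsp (l * n^-1)%g /\
    transports (f l) (f n) (om_inv om' l n (chr_part (l * n^-1)%g g))
      (om_inv om l n g').
  have GS : stab_fun (om_inv om' l n (chr_part (l * n^-1)%g g)) by apply:
    om_inv_stab.
  have [G' G'S GG'] := transports_exists phiP (fP l) (fP n) GS.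
  have [g' g'C g'E] := om_inv_surj omP G'S.
  by exists g'; split; rewrite ?g'E.
have [g_ g_P] := fin_all_exists gn.
exists (\sum_n g_ n) => n.
suff -> : chr_part (l * n^-1)%g (\sum_n g_ n) = g_ n by have [] := g_P n.
transitivity (\sum_i chr_part (l * n^-1)%g (g_ i)).
  apply/lfunP => h; rewrite chr_partE !sum_lfunE.
  by apply: eq_bigr => i _; rewrite chr_partE.
rewrite (bigD1 n) //= big1 => [|m mn]; rewrite (chr_part_id char0 _ (g_P _).1).
  by rewrite eqxx scale1r addr0.
case: eqP => [/mulgI/invg_inj e|_]; last by rewrite scale0r.
by rewrite e eqxx in mn.
Qed.

Lemma twist_rel_uniq l g' : twist_rel l 0 g' -> g' = 0.
Proof.
move=> R0; apply: (chr_part_eq0 (l := l)) => n; apply: (om_inv_inj omP).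
  exact: chr_part_charsp.
have := R0 n; rewrite (linear0_of (chr_part_linear _)) (linear0_of (om_inv_linear
  _ _ _)).
by move=> R0n; apply: (transports_uniq (fP l) R0n); apply: transports0.
Qed.

Lemma twist_rel_inj l g : twist_rel l g 0 -> g = 0.
Proof.
move=> R0; apply: (chr_part_eq0 (l := l)) => n; apply: (om_inv_inj omP').
  exact: chr_part_charsp.
have := R0 n; rewrite (linear0_of (chr_part_linear _)) (linear0_of (om_inv_linear
  om _ _)).
by apply: (transports_inj (fP n)); apply: dd_irr.
Qed.

Lemma twist_rel_rtrans l h g g' :
  twist_rel l g g' -> twist_rel l (rtrans H h g) (rtrans H h g').
Proof.
move=> R n; rewrite !chr_part_rtrans.
have shiftE (D0 : dyn_datum A) (om0 : forall l m,
    'Hom(Stab_mod (dd_mod D0 l) (dd_mod D0 m), C_mod (l * m^-1)%g)) g0 :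
    omega_choice om0 ->
    om_inv om0 l n (rtrans H h (chr_part (l * n^-1)%g g0))
      = (om_inv om0 l n (chr_part (l * n^-1)%g g0) \o rmul H h)%VF.
  move=> om0P; apply/lfunP => t; rewrite comp_lfunE rmulE om_inv_rtrans //.
  exact: chr_part_charsp.
by rewrite !shiftE //; apply: transports_shift.
Qed.

Lemma twist_rel_gl l (a : A) g g' : twist_rel l g g' ->
  twist_rel l (g \o lmul H (gl a))%VF (g' \o lmul H (gl a))%VF.
Proof.
move=> R n; rewrite !chr_part_gl !(linearZ_of _ _ (om_inv_linear _ _ _)).
rewrite -[_ *: om_inv om' _ _ _]addr0 -[_ *: om_inv om _ _ _]addr0.
by apply: transports_linear => //; apply: transports0.
Qed.

Lemma twist_rel_cou l : twist_rel l (ahval (cou H)) (ahval (cou H)).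
Proof.
move=> n; rewrite (chr_part_id char0 _ (cou_charsp A)).
have [e|ne] := eqVneq (l * n^-1)%g (1%g : chr k A); last first.
  rewrite !scale0r !(linear0_of (om_inv_linear _ _ _)); apply: transports0.
have <- : l = n by rewrite -[l](mulgKV n) e mul1g.
rewrite !scale1r => h p w; rewrite !om_inv_cou // scale_lfunE id_lfunE.
transitivity (tlift (fun a q =>
  (cou H a : k) *: ((cou H h : k) *: induced (f l) (q \ox w)))
   (rh_coact P p)).
  rewrite (counit (@rh_coact_cou k H E P) (F :=
    fun q => (cou H h : k) *: induced (f l) (q \ox w))) //.
  by lin.
apply: eq_tlift => a q;
  rewrite om_inv_cou // scale_lfunE id_lfunE rmorphM /= apdV_cou.
by rewrite scalerA pureZr linearZ.
Qed.

(** The comparison is bijective and H-equivariant, hence a left translation by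
    a unit u. It preserves each C(m), so u commutes with A, and it fixes the
    counit, so the counit of u is 1. *)
Lemma gauge_element l : exists u : H,
  [/\ u \is a GRing.unit, cou H u = 1, forall a : A, u * gl a = gl a * u
    & forall n g, g \in charsp (l * n^-1)%g ->
      transports (f l) (f n) (om_inv om' l n g) (om_inv om l n (g \o lmul H u)%VF)].
Proof.
have [u Ru] := translation_of_rel (@twist_rel_linear l) (@twist_rel_total l)
  (@twist_rel_uniq l) (@twist_rel_rtrans l).
have func := rel_functional (@twist_rel_linear l) (@twist_rel_uniq l).
have uA (a : A) : u * gl a = gl a * u.
  have sep (x y : H) : (forall g : dual H, g x = g y) -> x = y.
    move=> xy; apply: (can_inj v2rK); apply/rowP => i.
    have lc : linear (fun z : H => v2r z 0 i : k^o) by move=> c z t;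
      rewrite linearP !mxE.
    by have := xy (linfun (fun z : H => v2r z 0 i : k^o)); rewrite !linfunE.
  apply: sep => g.
  have := func _ _ _ (Ru (g \o lmul H (gl a))%VF) (twist_rel_gl a (Ru g)).
  by move/lfunP/(_ 1); rewrite !comp_lfunE !lmulE !mulr1.
exists u; split=> //.
- exact: (translation_unit (@twist_rel_inj l) Ru).
- have := func _ _ _ (Ru (ahval (cou H))) (@twist_rel_cou l).
  by move/lfunP/(_ 1); rewrite comp_lfunE lmulE mulr1 rmorph1.
move=> n g gC; have := Ru g n.
rewrite !(chr_part_id char0 _ (m := (l * n^-1)%g)) ?eqxx ?scale1r //.
apply/charspP => a h; rewrite !comp_lfunE !lmulE mulrA uA -mulrA.
by move/charspP: gC => ->.
Qed.
End GaugeElement.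

(** * Fusion and gauge equivalence *)

Section Weights.
Variables (k : closedFieldType) (H : hopfAlg k) (A : grouplike_sub H).
Implicit Types (l m n : chr k A) (X Y : lrep H).

Lemma apd_commute (u : H) :
  (forall a : A, u * gl a = gl a * u) -> forall a : A, apd H u * gl a
    = gl a * apd H u.
Proof.
move=> uA a; rewrite -[a]invgK -[gl _](apd_gl a^-1%g) -!apdM.
by rewrite uA.
Qed.

Lemma weight_lact X (u : H) m (x : X) :
  (forall a : A, u * gl a = gl a * u) -> weight m x -> weight m (lact X u x).
Proof.
move=> uA xm a; rewrite -comp_lfunE -lactM -uA lactM comp_lfunE xm.
by rewrite linearZ.
Qed.

Lemma weight_sub X m (x y : X) : weight m x -> weight m y -> weight m (x - y).
Proof. by move=> xm ym a; rewrite linearB /= xm ym scalerBr. Qed.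

Lemma ftilde_charsp X m (x : X) (F : dual X) :
  weight m x -> ftilde F x \in charsp m^-1%g.
Proof.
move=> xm; apply/charspP => a h.
rewrite !ftildeE apdM apd_gl lactM comp_lfunE xm linearZ linearZ /=.
by rewrite ffunE chrV.
Qed.

Lemma ftilde_linear X (F : dual X) : linear (fun x => ftilde F x).
Proof.
move=> c x y; apply/lfunP => h.
by rewrite add_lfunE scale_lfunE !ftildeE !linearP.
Qed.

Lemma rtrans_ftilde X (F : dual X) x h :
  rtrans H h (ftilde F x) = ftilde (F \o lact X (apd H h))%VF x.
Proof.
apply/lfunP => t; rewrite rtransE !ftildeE comp_lfunE apdM lactM.
by rewrite comp_lfunE.
Qed.

Lemma ftilde_lact_apd X (F : dual X) x u :
  ftilde F (lact X (apd H u) x) = (ftilde F x \o lmul H u)%VF.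
Proof.
apply/lfunP => t; rewrite comp_lfunE !ftildeE lmulE apdM lactM.
by rewrite comp_lfunE.
Qed.

Lemma chr_div l m : (l * (l * m)^-1 = m^-1)%g.
Proof. by rewrite [(l * m)%g]chr_mulC invMg mulgA mulgV mul1g. Qed.

Variables (D : dyn_datum A).
Variable om : forall l m,
  'Hom(Stab_mod (dd_mod D l) (dd_mod D m), C_mod (l * m^-1)%g).
Hypothesis omP : omega_choice om.

Lemma Psi_linear l n X (t : tens (dual X) (dd_mod D l)) :
  linear (fun x : X => Psi om l n x t).
Proof.
apply: linear_tlift => F v.
apply: linear_eval; apply: linear_eval => c x y.
by rewrite ftilde_linear om_inv_linear.
Qed.

Lemma om_inv_apply l m X (x : X) (F : dual X) h v : weight m x ->
  om_inv om l (l * m)%g (ftilde F x) h v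
    = Psi om l (l * m)%g x ((F \o lact X (apd H h))%VF \ox v).
Proof.
move=> xm; rewrite PsiE -rtrans_ftilde om_inv_rtrans ?mul1r //.
by rewrite chr_div ftilde_charsp.
Qed.

(** The value at h of the function attached to x is again a value of Psi, with
    f replaced by f (S(h) .). So Psi determines that function, and with it x. *)
Lemma Psi_inj l m X (x : X) : weight m x ->
  (forall t, Psi om l (l * m)%g x t = 0) -> x = 0.
Proof.
move=> xm x0.
have F0 (F : dual X) : F x = 0.
  have : ftilde F x = 0.
    apply: (om_inv_inj omP (l := l) (n := (l * m)%g));
      first by rewrite chr_div ftilde_charsp.
    by apply/lfunP => h; apply/lfunP => v; rewrite om_inv_apply // x0 !zero_lfunE.
  by move/lfunP/(_ 1); rewrite ftildeE apd1 lact1 id_lfunE zero_lfunE.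
apply: (can_inj v2rK); rewrite linear0; apply/rowP => i; rewrite [RHS]mxE.
have lc : linear (fun z : X => v2r z 0 i : k^o) by move=> c z t;
  rewrite linearP !mxE.
by have := F0 (linfun (fun z : X => v2r z 0 i : k^o)); rewrite linfunE.
Qed.
End Weights.

Section DualTensor.
Variables (k : closedFieldType) (H : hopfAlg k).

Lemma dual_tensE (X Y : vectType k) (f : dual X) (g : dual Y) x y :
  dual_tens f g (x \ox y) = (f x : k^o) * g y.
Proof.
rewrite /dual_tens tliftE //; split=> [v|v] c a b.
  by rewrite linearP mulrDl -scalerAl.
by rewrite linearP mulrDr -scalerAr.
Qed.

Lemma dual_tens_bilin (X Y : vectType k) : bilin (@dual_tens k X Y).
Proof.
split=> [g|f] c a b; apply: tens_ext => x y;
  rewrite !(add_lfunE, scale_lfunE) !dual_tensE.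
  by rewrite !(add_lfunE, scale_lfunE) mulrDl -scalerAl.
by rewrite !(add_lfunE, scale_lfunE) mulrDr -scalerAr.
Qed.

Lemma dual_tens_surj (X Y : vectType k) (F : dual (tens X Y)) :
  exists z : tens (dual X) (dual Y), F = tlift (@dual_tens k X Y) z.
Proof.
pose co (V : vectType k) i : dual V := linfun (fun x : V => v2r x 0 i : k^o).
have coE V i x : co V i x = v2r x 0 i.
  by rewrite linfunE // => c y z; rewrite linearP !mxE.
exists (\sum_i \sum_j (F (vbase i \ox vbase j) : k) *: (co X i \ox co Y j)).
apply: tens_ext => x y; rewrite !linear_sum sum_lfunE.
rewrite {1}(vbase_sum x) (linear_sumZ _ _ _ (pureDl y)) linear_sum.
apply: eq_bigr => i _; rewrite !linear_sum sum_lfunE linearZ /=.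
rewrite {1}(vbase_sum y) (linear_sumZ _ _ _ (pureDr _)) linear_sum scaler_sumr.
apply: eq_bigr => j _; rewrite !linearZ /= scale_lfunE.
rewrite tliftE; last exact: dual_tens_bilin.
rewrite dual_tensE !coE.
have swap (a b c : k) : a * (b * c)
  = c * (b * a) by rewrite mulrA mulrC [a * b]mulrC.
exact: swap.
Qed.

Lemma dual_tens_act (X Y : lrep H) (f : dual X) (g : dual Y) h :
  (dual_tens f g \o lact (tens_mod X Y) h)%VF
    = tlift (fun a b => dual_tens (f \o lact X a)%VF (g \o lact Y b)%VF) (cop H h).
Proof.
apply: tens_ext => x y; rewrite [RHS]eval_tlift (comp_lfunE (dual_tens f g)).
rewrite [lact (tens_mod X Y) h](comp_lfunE (tact (lact X) (lact Y))) {1}/tact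
  eval_tlift.
rewrite (app_tlift (dual_tens f g)); apply: eq_tlift => a b.
by rewrite tmapE !dual_tensE (comp_lfunE f) (comp_lfunE g).
Qed.

Lemma dual_tens_assocE (X Y V : vectType k) (f : dual X) (g : dual Y) (v : V) :
  dual_tens_assoc X Y V (g \ox (f \ox v)) = dual_tens f g \ox v.
Proof.
have [dl dr] := dual_tens_bilin X Y.
have b2 (g' : dual Y) : bilin (fun (f : dual X) (v : V) => dual_tens f g' \ox v).
  by split=> [w|f']; [apply: (linear_purel (f := fun f0 => dual_tens f0 g'));
    apply: dl | lin].
rewrite tliftE ?tliftE //; split=> [t|g']; last by lin.
apply: (linear_tlift (f :=
  fun g (f : dual X) (v : V) => dual_tens f g \ox v)) => f' v'.
by apply: (linear_purel (f := fun g0 => dual_tens f' g0)); apply: dr.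
Qed.
End DualTensor.

Section Fusion.
Variables (k : closedFieldType) (char0 : [pchar k] =i pred0).
Variables (H : hopfAlg k) (A : grouplike_sub H) (D E : dyn_datum A).
Variables (P : relHopfMod E) (phi : 'Hom(D, 'End(P))).
Variable f : forall l, 'Hom(tensS P (dd_mod E l), dd_mod D l).
Hypothesis fP : forall l, [/\ lker (f l) = 0%VS, limg (f l) = fullv
  & forall x p w, f l (pureS (phi x p) w) = lact (dd_mod D l) x (f l (pureS p w))].
Variable om : forall l m,
  'Hom(Stab_mod (dd_mod D l) (dd_mod D m), C_mod (l * m^-1)%g).
Variable om' : forall l m,
  'Hom(Stab_mod (dd_mod E l) (dd_mod E m), C_mod (l * m^-1)%g).
Hypotheses (omP : omega_choice om) (omP' : omega_choice om').
Variable u : chr k A -> H.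
Hypothesis uA : forall l (a : A), u l * gl a = gl a * u l.
Hypothesis u_transports : forall l n g, g \in charsp (l * n^-1)%g ->
  transports (f l) (f n) (om_inv om' l n g) (om_inv om l n (g \o lmul H (u l))%VF).
Implicit Types (l m n : chr k A) (X Y : lrep H).
Local Notation b l := (induced (f l)).

(** Psi_K(S(u) x) is the image of Psi_S(x) under P (x)_S -: on S-modules, the
    element g of H that moves past the factor in P acts on the functional F. *)
Lemma Psi_transport l m n X (x : X) (F : dual X) p w :
  n = (l * m)%g -> weight m x ->
  Psi om l n (lact X (apd H (u l)) x) (F \ox b l (p \ox w))
    = tlift (fun g q => b n (q \ox Psi om' l n x ((F \o lact X g)%VF \ox w)))
        (rh_coact P p).
Proof.
move=> -> xm; rewrite PsiE ftilde_lact_apd.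
have FC : ftilde F x \in charsp (l * (l * m)^-1)%g by rewrite chr_div ftilde_charsp.
rewrite (u_transports FC); apply: eq_tlift => g q.
by rewrite om_inv_apply // mulr1 apdVK.
Qed.

Variables (I I' : chr k A -> tens H H).
Hypotheses (IP : fusion om I) (IP' : fusion om' I').

(** Both sides have the same image under Psi_K, namely the image under P (x)_S -
    of the composite Psi_S(y) (id (x) Psi_S(x)). On one side the functor is
    applied after composing in S-modules, on the other side before composing
    in K-modules. The two agree by coassociativity on P. *)
Lemma fusion_transport l m n X Y (x : X) (y : Y) : weight m x -> weight n y ->
  lact (tens_mod X Y) (apd H (u l)) (tact (lact X) (lact Y) (I' l) (x \ox y))
    = tact (lact X) (lact Y) (I l)
        (lact X (apd H (u l)) x \ox lact Y (apd H (u (l * m)%g)) y).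
Proof.
move=> xm yn.
set z' : tens_mod X Y := tact _ _ (I' l) _.
set z : tens_mod X Y := tact _ _ (I l) _.
have Sx : weight m (lact X (apd H (u l)) x) by apply: weight_lact => //;
  apply: apd_commute.
have Sy : weight n (lact Y (apd H (u (l * m)%g)) y).
  by apply: weight_lact => //; apply: apd_commute.
have [wz Iz] := IP l Sx Sy; have [wz' Iz'] := IP' l xm yn.
rewrite -/z in wz Iz; rewrite -/z' in wz' Iz'.
rewrite -mulgA in Iz Iz'.
have wSz' : weight (m * n)%g (lact (tens_mod X Y) (apd H (u l)) z').
  by apply: weight_lact => //; apply: apd_commute.
apply/eqP; rewrite -subr_eq0; apply/eqP.
apply: (Psi_inj omP (l := l) (m := (m * n)%g)); first exact: weight_sub.
move=> t; rewrite addrC -scaleN1r Psi_linear scaleN1r addrC.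
apply/eqP; rewrite subr_eq0; apply/eqP.
have key (F : dual X) (G : dual Y) p w :
    Psi om l (l * (m * n))%g (lact (tens_mod X Y) (apd H (u l)) z')
      (dual_tens F G \ox b l (p \ox w))
    = Psi om l (l * (m * n))%g z (dual_tens F G \ox b l (p \ox w)).
  rewrite (Psi_transport _ _ _ (erefl _) wz').
  have /lfunP/(_ (G \ox (F \ox b l (p \ox w)))) := Iz.
  rewrite (comp_lfunE (Psi om l _ z)) dual_tens_assocE => ->.
  rewrite (comp_lfunE (Psi om (l * m)%g _ _)) tmapE id_lfunE.
  rewrite (Psi_transport _ _ _ (erefl _) xm).
  rewrite (linear_tliftE (L := fun v => Psi om (l * m)%g _ _ (G \ox v)));
    last by lin.
  transitivity (tlift (fun a q => tlift (fun c r => b (l * (m * n))%g (r \ox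
      Psi om' l (l * (m * n))%g z'
        (dual_tens (F \o lact X a)%VF (G \o lact Y c)%VF \ox w)))
      (rh_coact P q)) (rh_coact P p)); last first.
    apply: eq_tlift => a q.
    rewrite (Psi_transport _ _ _ (mulgA _ _ _) yn); apply: eq_tlift => c r.
    have /lfunP/(_ ((G \o lact Y c)%VF \ox ((F \o lact X a)%VF \ox w))) := Iz'.
    rewrite (comp_lfunE (Psi om' l _ z')) dual_tens_assocE => ->.
    by rewrite (comp_lfunE (Psi om' (l * m)%g _ _)) tmapE id_lfunE.
  have [dl dr] := dual_tens_bilin X Y.
  have ldl (F0 : H -> dual X) (G0 : dual Y) : linear F0 ->
    linear (fun a => dual_tens (F0 a) G0).
    by move=> lF c v v'; rewrite lF; apply: dl.
  have ldr (F0 : dual X) (G0 : H -> dual Y) : linear G0 ->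
    linear (fun a => dual_tens F0 (G0 a)).
    by move=> lG c v v'; rewrite lG; apply: dr.
  rewrite -(coassoc (@rh_coactA k H E P)).
  - apply: eq_tlift => c r; rewrite dual_tens_act.
    rewrite (linear_tliftE (L := fun F => b _ (r \ox Psi om' l _ z' (F \ox w)))) //.
    by lin.
  - lin_steps; apply: (ldl (fun a => (F \o lact X a)%VF)); lin.
  - lin_steps; apply: (ldr _ (fun c => (G \o lact Y c)%VF)); lin.
  - by lin.
apply: (eq_linear_tens (f := fun t => Psi om l _ _ t) (g :=
  fun t => Psi om l _ _ t)); try by lin.
move=> F v; have [s ->] := dual_tens_surj F; have [y0 ->] := induced_surj (fP l) v.
apply: (eq_linear_tens (f := fun s => Psi om l _ _ (tlift _ s \ox _))
  (g := fun s => Psi om l _ _ (tlift _ s \ox _))); try by lin.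
move=> F1 G1; rewrite tliftE; last exact: dual_tens_bilin.
apply: (eq_linear_tens (f := fun y => Psi om l _ _ (_ \ox b l y))
  (g := fun y => Psi om l _ _ (_ \ox b l y))); try by lin.
Qed.

(** [fusion_transport] for the regular module, at the vectors P_m and P_n. The
    sum over all m and n turns P_m (x) P_n into the unit. *)
Lemma fusion_gauge l :
  cop H (apd H (u l)) * I' l
    = I l * \sum_(m : chr k A) (apd H (u l) * idem m) \ox apd H (u (l * m)%g).
Proof.
have wi m : weight m (idem m : reg_mod H) by move=> a; rewrite lmulE gl_idem.
rewrite -[LHS]mulr1 tens1E -{1}(sum_idem char0 A) -(sum_idem char0 A).
rewrite (linear_sum_of (f := fun x => x \ox _)); last by lin.
rewrite !mulr_sumr; apply: eq_bigr => m _.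
transitivity (I l * ((apd H (u l) * idem m) \ox
    (apd H (u (l * m)%g) * \sum_(n : chr k A) idem n))); last first.
  by rewrite sum_idem // mulr1.
rewrite mulr_sumr !(linear_sum_of (f := fun x => _ \ox x)); try by lin.
rewrite !mulr_sumr; apply: eq_bigr => n _.
have tE z z' : tact (lact (reg_mod H)) (lact (reg_mod H)) z z' = z * z' by [].
have cE h z : lact (tens_mod (reg_mod H) (reg_mod H)) h z = cop H h * z.
  by rewrite -tE -(comp_lfunE _ (cop H)).
by rewrite -mulrA; have := fusion_transport l (wi m) (wi n); rewrite cE !tE !lmulE.
Qed.
End Fusion.

Section Reversal.
Variables (k : closedFieldType) (H : hopfAlg k).

(** The algebra anti-automorphism (S^-1 (x) S^-1) o flip, which carries the
    inverse of a fusion operator to the dynamical twist. *)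
Definition apdV_swap (z : tens H H) : tens H H :=
  tmap (apdV H) (apdV H) (tswap H H z).

Lemma apdV_swap_linear : linear apdV_swap.
Proof. by move=> c x y; rewrite /apdV_swap !linearP. Qed.

Lemma apdV_swapE x y : apdV_swap (x \ox y) = apdV H y \ox apdV H x.
Proof. by rewrite /apdV_swap tswapE tmapE. Qed.

Lemma apdV_swapM y z : apdV_swap (y * z) = apdV_swap z * apdV_swap y.
Proof.
apply: (eq_linear_tens (f := fun y => apdV_swap (y * z))
  (g := fun y => apdV_swap z * apdV_swap y)).
- by move=> c a b; rewrite mulrDl -scalerAl apdV_swap_linear.
- by move=> c a b; rewrite apdV_swap_linear mulrDr -scalerAr.
move=> a b; apply: (eq_linear_tens (f := fun z => apdV_swap (_ * z))
  (g := fun z => apdV_swap z * _)).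
- by move=> c x y'; rewrite mulrDr -scalerAr apdV_swap_linear.
- by move=> c x y'; rewrite apdV_swap_linear mulrDl -scalerAl.
by move=> c d; rewrite pureM !apdV_swapE pureM !apdVM.
Qed.

Lemma apdV_swap_cop x : apdV_swap (cop H (apd H x)) = cop H x.
Proof.
rewrite cop_apd (linear_tliftE _ _ apdV_swap_linear) -[RHS]tlift_pure.
by apply: eq_tlift => a b; rewrite apdV_swapE !apdK.
Qed.
End Reversal.

Section GaugeEquivalence.
Variables (k : closedFieldType) (char0 : [pchar k] =i pred0).
Variables (H : hopfAlg k) (A : grouplike_sub H) (u : chr k A -> H).
Hypothesis u_unit : forall l, u l \is a GRing.unit.
Hypothesis uA : forall l (a : A), u l * gl a = gl a * u l.

(** The sum in the hypothesis is inverted termwise, by orthogonality of the P_m.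
    Inverting the relation and reversing it gives the gauge relation with
    t(l) = u(l)^-1; as S^-1(P_m) is the idempotent of m^-1, the index m becomes
    m^-1. *)
Lemma gauge_twist (I I' : tens H H) (l : chr k A) :
  I \is a GRing.unit -> I' \is a GRing.unit ->
  cop H (apd H (u l)) * I'
    = I * (\sum_(m : chr k A) (apd H (u l) * idem m) \ox apd H (u (l * m)%g)) ->
  apdV_swap I'^-1 = cop H (u l) * apdV_swap I^-1
    * \sum_(m : chr k A) (u (l * m^-1)%g)^-1 \ox (idem m * (u l)^-1).
Proof.
move=> I_unit I'_unit; set M := \sum_m _ => eqI.
pose v m := (u m)^-1.
have uv m : apd H (u m) * apd H (v m) = 1 by rewrite -apdM mulVr ?apd1.
pose N := \sum_(m : chr k A) (idem m * apd H (v l)) \ox apd H (v (l * m)%g).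
have MN : M * N = 1.
  transitivity (\sum_(m : chr k A) (apd H (u l) * idem m * apd H (v l)) \ox (1 :
    H)).
    rewrite /M mulr_suml; apply: eq_bigr => m _.
    rewrite /N mulr_sumr (bigD1 m) //= big1 => [|n nm].
      by rewrite addr0 pureM uv mulrA -[_ * idem m * idem m]mulrA idemM // eqxx
        scale1r.
    rewrite pureM mulrA -[_ * idem m * idem n]mulrA idemM // eq_sym (negPf nm).
    by rewrite scale0r mulr0 mul0r pure0l.
  rewrite -(linear_sum_of (f := fun x => x \ox (1 : H))); last by lin.
  by rewrite -mulr_suml -mulr_sumr sum_idem // mulr1 uv.
have copuv : cop H (apd H (v l)) * cop H (apd H (u l)) = 1.
  by rewrite -rmorphM /= -apdM mulrV ?apd1 ?rmorph1.
have -> : I'^-1 = N * I^-1 * cop H (apd H (u l)).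
  apply: (mulrI I'_unit); rewrite mulrV //; symmetry.
  have -> : I' = cop H (apd H (v l)) * (cop H (apd H (u l)) * I').
    by rewrite mulrA copuv mul1r.
  move: eqI MN copuv; move: (cop H _) (cop H _) => x y; clearbody M N => -> MN xy.
  by rewrite -!mulrA (mulrA M) MN mul1r (mulrA I) mulrV // mul1r xy.
rewrite !apdV_swapM apdV_swap_cop mulrA; congr (_ * _).
rewrite /N (linear_sum_of (@apdV_swap_linear _ _)).
rewrite (reindex_inj invg_inj) /=; apply: eq_bigr => m _.
rewrite apdV_swapE apdK apdVM apdK -[idem m^-1%g]apd_idem apdK.
congr (_ \ox _); apply: idem_commute => a.
by apply/esym/commrV; rewrite /GRing.comm uA.
Qed.
End GaugeEquivalence.

Theorem proposition3p17 (k : closedFieldType) (char0 : [pchar k] =i pred0)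
    (H : hopfAlg k) (A : grouplike_sub H) (D E : dyn_datum A)
    (J J' : dyn_twist A) :
  datum_equiv D E -> assoc_twist D J -> assoc_twist E J' -> gauge_equiv J J'.
Proof.
move=> [P [phi [phiP f_ex]]] [om [omP [I [IP I_unit JE]]]].
move=> [om' [omP' [I' [IP' I'_unit JE']]]].
have [f fP] := fin_all_exists f_ex.
have [u uP] := fin_all_exists (gauge_element char0 phiP fP omP omP').
have u_unit l : u l \is a GRing.unit by have [] := uP l.
have u_cou l : cou H (u l) = 1 by have [] := uP l.
have uA l (a : A) : u l * gl a = gl a * u l by have [_ _ ->] := uP l.
exists (fun l => (u l)^-1); split=> [l|l|l a|l].
- by rewrite unitrV.
- have := congr1 (cou H) (mulVr (u_unit l)).
  by rewrite rmorphM rmorph1 /= u_cou mulr1.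
- by apply/esym/commrV; rewrite /GRing.comm uA.
rewrite invrK JE JE'; apply: gauge_twist => //.
apply: (fusion_gauge char0 fP omP omP' uA _ IP IP') => l' n g gC.
by have [_ _ _] := uP l'; apply.
Qed.
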